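(* If $M$ is a compact complex manifold, then for every $r\geq 1$ $$h^{\mathrm{BC}}_{1,1}(M)+2\dim E^{0,2}_r(M)\;\geq\; b_2(M).$$ Moreover, if $M$ satisfies the $\partial\bar\partial$-lemma, then all of these inequalities are equalities.
   Context: $E_r^{p,q}(M)$ denotes the $(p,q)$-term at step $r$ of the Frölicher spectral sequence of $M$ (so $E_1^{p,q}(M)\cong H^{p,q}_{\bar\partial}(M)$ is Dolbeault cohomology and the sequence converges to de Rham cohomology with complex coefficients). The Bott-Chern cohomology groups are $H^{p,q}_{\mathrm{BC}}(M)=\ker\{d:\Omega^{p,q}(M)\to\Omega^{p+q+1}(M)\}/\mathrm{im}\{\partial\bar\partial:\Omega^{p-1,q-1}(M)\to\Omega^{p,q}(M)\}$, with (finite) dimensions $h^{\mathrm{BC}}_{p,q}(M)$, and $b_2(M)$ is the second Betti number. $M$ satisfies the $\partial\bar\partial$-lemma if $\ker\partial\cap\ker\bar\partial\cap\mathrm{im}\,d=\mathrm{im}\,\partial\bar\partial$, i.e. every $\partial$-closed, $\bar\partial$-closed and $d$-exact complex form on $M$ is $\partial\bar\partial$-exact. *)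

(* Defs.v *)
From HB Require Import structures.
From mathcomp Require Import all_boot all_order all_algebra complex.
From mathcomp Require Import all_classical all_reals all_analysis.
Set Implicit Arguments.
Unset Strict Implicit.
Unset Printing Implicit Defensive.
Import Order.TTheory GRing.Theory Num.Theory numFieldNormedType.Exports.
Local Open Scope classical_set_scope.
Local Open Scope ring_scope.

(* C^n is modelled by R^n x R^n, the pair (x, y) standing for the point with  *)
(* complex coordinates z_j = x_j + i y_j; this gives access to the library's  *)
(* real Frechet derivatives.                                                  *)
Notation cspace R n := ('rV[R]_n * 'rV[R]_n)%type.

(* Labels of the complexified coordinates: inl j stands for z_j and inr j for *)
(* its conjugate.                                                             *)
Notation clabel n := ('I_n + 'I_n)%type.

Section Calculus.
Variables (R : realType) (n : nat).
Implicit Types (U : set (cspace R n)) (f : cspace R n -> R[i]).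

Fixpoint times_differentiable (k : nat) U (g : cspace R n -> R) : Prop :=
  if k is k'.+1 then
    (forall x, U x -> differentiable g x) /\
    (forall v, times_differentiable k' U (fun x => 'D_v g x))
  else True.

(* Meant for open U, as are all the predicates "on U" below. *)
Definition smooth_on U f : Prop :=
  forall k, times_differentiable k U (fun x => complex.Re (f x)) /\
            times_differentiable k U (fun x => complex.Im (f x)).

Definition cderive (v : cspace R n) f (x : cspace R n) : R[i] :=
  (('D_v (fun y => complex.Re (f y)) x) +i*
   ('D_v (fun y => complex.Im (f y)) x))%C.

(* Wirtinger derivatives: d/dz_j = (d/dx_j - i d/dy_j) / 2 for inl j, and     *)
(* d/d(conj z_j) = (d/dx_j + i d/dy_j) / 2 for inr j.                         *)
Definition wirtinger (a : clabel n) f (x : cspace R n) : R[i] :=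
  match a with
  | inl j => (cderive (delta_mx 0 j, 0) f x
              - 'i%C * cderive (0, delta_mx 0 j) f x) / 2%:R
  | inr j => (cderive (delta_mx 0 j, 0) f x
              + 'i%C * cderive (0, delta_mx 0 j) f x) / 2%:R
  end.

Definition ccoord (a : clabel n) (x : cspace R n) : R[i] :=
  match a with
  | inl j => (x.1 ord0 j +i* x.2 ord0 j)%C
  | inr j => (x.1 ord0 j -i* x.2 ord0 j)%C
  end.

(* Smooth and satisfying the Cauchy-Riemann equations. *)
Definition holomorphic_on U (phi : cspace R n -> cspace R n) : Prop :=
  forall j : 'I_n,
    smooth_on U (fun x => ccoord (inl j) (phi x)) /\
    (forall (k : 'I_n) x, U x ->
       wirtinger (inr k) (fun y => ccoord (inl j) (phi y)) x = 0).

End Calculus.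

(* A complex manifold of complex dimension n, given by a holomorphic atlas.   *)
(* Only the values of coord i on dom i and of param i on cod i matter.        *)
Record complex_manifold (R : realType) (n : nat) := ComplexManifold {
  points :> topologicalType;
  points_hausdorff : hausdorff_space points;
  points_second_countable : @second_countable points;
  chart : Type;
  dom : chart -> set points;
  cod : chart -> set (cspace R n);
  coord : chart -> points -> cspace R n;
  param : chart -> cspace R n -> points;
  dom_open : forall i, open (dom i);
  cod_open : forall i, open (cod i);
  dom_cover : forall m, exists i, dom i m;
  coord_cod : forall i m, dom i m -> cod i (coord i m);
  param_dom : forall i x, cod i x -> dom i (param i x);
  coordK : forall i m, dom i m -> param i (coord i m) = m;
  paramK : forall i x, cod i x -> coord i (param i x) = x;
  coord_continuous : forall i, {within dom i, continuous (coord i)};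
  param_continuous : forall i, {within cod i, continuous (param i)};
  transition_holomorphic : forall i j,
    holomorphic_on (cod i `&` param i @^-1` dom j)
                   (fun x => coord j (param i x))
}.

Section Forms.
Variables (R : realType) (n : nat) (M : complex_manifold R n).

(* A complex differential form is given by its components in every chart: for *)
(* s = [:: a_1; ...; a_k], w i s is the component w_{a_1...a_k} of            *)
(*   w = sum_k 1/k! sum_{a_1,...,a_k} w_{a_1...a_k} dw_{a_1} /\ ... /\ dw_{a_k}*)
(* where dw_(inl j) = dz_j and dw_(inr j) = d(conj z_j).  Forms of all degrees*)
(* are thus added together, the degree of a component being size s.           *)
Definition components : Type :=
  chart M -> seq (clabel n) -> cspace R n -> R[i].

(* Components are set to 0 off the image of the chart so that two equal forms *)
(* have equal components.                                                     *)
Record is_form (w : components) : Prop := IsForm {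
  form_outside : forall i s x, ~ cod i x -> w i s x = 0;
  form_smooth : forall i s, smooth_on (cod i) (w i s);
  form_alternating : forall i s1 a b s2 x,
    w i (s1 ++ [:: a, b & s2]) x = - w i (s1 ++ [:: b, a & s2]) x;
  form_change_of_chart : forall i j s x, cod i x -> dom j (param i x) ->
    w i s x = \sum_(t : (size s).-tuple (clabel n))
      (\prod_(k < size s)
         wirtinger (tnth (in_tuple s) k)
           (fun y => ccoord (tnth t k) (coord j (param i y))) x)
      * w j t (coord j (param i x))
}.

(* The part of the exterior derivative                                        *)
(*   (d w)_{a_0...a_k} = sum_l (-1)^l d(w_{a_0...^a_l...a_k})/dw_{a_l}        *)
(* where only the labels satisfying P are differentiated.                     *)
Definition partial_d (P : pred (clabel n)) (w : components) : components :=
  fun i s x =>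
    if x \in cod i then
      \sum_(l < size s | P (tnth (in_tuple s) l))
        (-1) ^+ l *
        wirtinger (tnth (in_tuple s) l) (w i (take l s ++ drop l.+1 s)) x
    else 0.

Definition ext_d : components -> components := partial_d predT.
Definition del : components -> components := partial_d (fun a => is_inl a).
Definition delbar : components -> components := partial_d (fun a => ~~ is_inl a).

(* The forms whose components all have a bidegree (p, q) satisfying P, i.e.   *)
(* the direct sum of the Omega^{p,q} with P p q.                              *)
Definition forms_of_bidegree (P : int -> int -> Prop) : set components :=
  [set w | is_form w /\
    forall i s x, w i s x != 0 ->
      P (count (fun a => is_inl a) s)%:Z (count (fun a => ~~ is_inl a) s)%:Z].

Definition Omega_pq (p q : int) : set components :=
  forms_of_bidegree (fun p' q' => p' = p /\ q' = q).

Definition Omega_deg (k : int) : set components :=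
  forms_of_bidegree (fun p' q' => p' + q' = k).

(* The Hodge filtration F^p Omega^k. *)
Definition hodge_filtration (p k : int) : set components :=
  forms_of_bidegree (fun p' q' => p' + q' = k /\ p <= p').

End Forms.

Arguments Omega_pq {R n} M p q.
Arguments Omega_deg {R n} M k.
Arguments hodge_filtration {R n} M p k.

(* dim (Z / B), for linear subspaces B <= Z of E: the supremum in [0, +oo] of *)
(* the sizes of the families in Z that are linearly independent modulo B.     *)
Definition dim_quotient (R : realType) (E : lmodType R[i]) (Z B : set E)
  : \bar R :=
  ereal_sup [set (m%:R%:E)%E | m in [set m : nat |
    exists2 v : 'I_m -> E, (forall k, Z (v k)) &
      forall c : 'I_m -> R[i], B (\sum_k c k *: v k) -> forall k, c k = 0]].

Section Cohomology.
Variables (R : realType) (n : nat) (M : complex_manifold R n).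
Local Notation d := (@ext_d R n M).

(* H^k_dR(M; C) = ker d / im d. *)
Definition betti (k : int) : \bar R :=
  dim_quotient [set w | Omega_deg M k w /\ d w = 0]
               (d @` Omega_deg M (k - 1)).

Definition dim_bott_chern (p q : int) : \bar R :=
  dim_quotient [set w | Omega_pq M p q w /\ d w = 0]
    ((fun w => del (delbar w)) @` Omega_pq M (p - 1) (q - 1)).

(* The Frolicher spectral sequence is that of the complex of complex forms    *)
(* filtered by F^p, with pages                                                *)
(*   E_r^{p,q} =                                                              *)
(*     Z_r^{p,q} / (Z_{r-1}^{p+1,q-1} + d Z_{r-1}^{p-r+1,q+r-2}),             *)
(*   Z_r^{p,q} = {w in F^p Omega^{p+q} | d w in F^{p+r} Omega^{p+q+1}}.       *)
Definition frolicher_Z (r p q : int) : set (components M) :=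
  [set w | hodge_filtration M p (p + q) w /\
           hodge_filtration M (p + r) (p + q + 1) (d w)].

Definition frolicher_B (r p q : int) : set (components M) :=
  [set u + d v | u in frolicher_Z (r - 1) (p + 1) (q - 1)
               & v in frolicher_Z (r - 1) (p - r + 1) (q + r - 2)].

Definition dim_frolicher (r : nat) (p q : int) : \bar R :=
  dim_quotient (frolicher_Z r%:Z p q) (frolicher_B r%:Z p q).

Definition ddbar_lemma : Prop :=
  [set w | is_form w /\ del w = 0] `&` [set w | is_form w /\ delbar w = 0]
    `&` d @` [set w | is_form w]
  = (fun w => del (delbar w)) @` [set w | is_form w].

End Cohomology.

(* Main.v *)
Require Import Defs.
From mathcomp Require Import all_boot all_order all_algebra complex.
From mathcomp Require Import all_classical all_reals all_analysis.
From mathcomp Require Import ring lra zify.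
Set Implicit Arguments.
Unset Strict Implicit.
Unset Printing Implicit Defensive.
Import Order.TTheory GRing.Theory Num.Theory numFieldNormedType.Exports.
Local Open Scope classical_set_scope.
Local Open Scope ring_scope.

(* A closed 2-form w has classes [w] and [conj w] in E_r^{0,2} = Z_r / B_r, so
   the bound amounts to the claim that a w with both classes zero is cohomologous
   to a closed (1,1)-form.  If w = u + d v and conj w = u' + d v' with u, u' in
   F^1, put eta = conj v' - v; then
     u - d eta^{1,0} = conj u' + d eta^{0,1}
   lies in F^1 and in conj F^1, hence has type (1,1).  Under the
   ddbar-lemma, every w in Z_r^{0,2} is congruent modulo B_r to a closed
   (0,2)-form w^{0,2} - dbar xi, where del w^{0,2} = del dbar xi; closed forms of types (0,2), (2,0) and (1,1) that
   are independent in E_r^{0,2}, its conjugate and H_BC^{1,1} are then jointly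
   independent in H^2.

   Forms are handled through contractions iota_a with the coordinate fields:
   d is characterised by iota_a d = D_a - d iota_a, and the pullback T along a
   map with Jacobian J by iota_a T = sum_b J_ab T iota_b, which turns d^2 = 0 and
   d T = T d into inductions on the degree. *)

(** * Symmetry of second derivatives *)

(** The factor 2 counts [E_r^{0,2}] and its complex conjugate: conjugation is antilinear and
    preserves dimensions. The identity for eta comes from equating the two expressions u + d v and
    conj u' + d (conj v') of w. Splitting eta by type works because d eta^{1,0} stays in F^1 and d
    eta^{0,1} in its conjugate, and in degree 2 these two meet exactly in type (1,1). Joint
    independence rests on one remark: if p1 + p2 + p3 = d eta with closed p1, p2, p3 of types (0,2),
    (2,0), (1,1), then p1 = -(p2 + p3) + d eta with p2 + p3 in F^1, so p1 is zero in [E_r^{0,2}].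
    Conjugation treats p2 alike, and an exact p3 is zero in Bott-Chern cohomology by the
    ddbar-lemma. Dimensions are suprema in [0, +oo], so every inequality is argued on finite
    independent families and matrices over C. The change of charts is compatible with d by d T = T
    d. For del and delbar it is reached through bidegree: a holomorphic transition map has no mixed
    Jacobian entries, so bidegree components of forms are forms, and on pure type del and delbar are
    components of d. *)

Section Schwarz.
Variables (R : realType) (V : normedModType R).
Implicit Types (g : V -> R) (x u v : V).

Let second_difference g x u v (h : R) : R :=
  g (x + h *: u + h *: v) - g (x + h *: u) - g (x + h *: v) + g x.

Lemma is_derive_line g x u (t : R) : differentiable g (x + t *: u) ->
  is_derive t 1 (fun s : R => g (x + s *: u)) ('D_u g (x + t *: u)).
Proof.
move=> dg.
have da : is_diff t (fun s : R => x + s *: u) ( *:%R^~ u).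
  have -> : ( *:%R^~ u) = 0 + ( *:%R^~ u) :> (R -> V).
    by apply/funext => s; rewrite fctE add0r.
  exact: is_diffD.
have dgt : differentiable g ((fun s : R => x + s *: u) t) by [].
have dc := is_diff_comp da (differentiableP dgt).
case: dc => dd dv.
apply: DeriveDef; first exact: diff_derivable.
by rewrite !deriveE // [in LHS]dv /= scale1r.
Qed.

(** The second difference is the increment over [0, h] of s |-> g (x + h v + s u) - g (x + s u). *)
Let second_difference_mvt g x u v (h : R) : 0 < h ->
  (forall s : R, 0 <= s <= h -> differentiable g (x + s *: u) /\
     differentiable g (x + h *: v + s *: u)) ->
  exists2 t, 0 <= t <= h & second_difference g x u v h =
    ('D_u g (x + h *: v + t *: u) - 'D_u g (x + t *: u)) * h.
Proof.
move=> h0 dg.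
pose f (s : R) := g (x + h *: v + s *: u) - g (x + s *: u).
pose df (s : R) := 'D_u g (x + h *: v + s *: u) - 'D_u g (x + s *: u).
have fd s : 0 <= s <= h -> is_derive s 1 f (df s).
  by move=> /dg[d1 d2]; apply: is_deriveB; exact: is_derive_line.
have [|||c ch e] := @MVT_segment R f df 0 h.
- exact: ltW.
- by move=> s; rewrite in_itv /= => /andP[s0 sh]; apply: fd; rewrite !ltW.
- apply: derivable_within_continuous => s; rewrite in_itv /= => sh.
  by case: (fd _ sh).
exists c; first by move: ch; rewrite in_itv.
move: e; rewrite subr0 /f /df => <-; rewrite !scale0r !addr0 /second_difference.
by rewrite (addrAC x); lra.
Qed.

(** After the mean value theorem, ['D_u g] is linearised at x in the two displacements h v + t u and
    t u. The linear parts differ by h times ['D_v ('D_u g) x]; the errors add up to e (|h v + t u| +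
    |t u|), at most e h (|u| + |u| + |v|). *)
Let second_difference_approx g x u v :
  (\forall y \near x, differentiable g y) -> differentiable ('D_u g) x ->
  forall e, 0 < e -> \forall h \near 0^'+,
    `|second_difference g x u v h - 'D_v ('D_u g) x * (h * h)|
      <= e * (`|u| + `|u| + `|v|) * (h * h).
Proof.
move=> dg dgu e e0; set F := 'D_u g; pose L := 'd F x.
have : \forall y \near (0 : V), differentiable g (x + y) /\
    `|F (x + y) - F x - L y| <= e * `|y|.
  have /nbhs_normP[r1 /= r1gt0 r1P] := dg.
  have /diff_locally/eqaddoP/(_ e e0) H := dgu.
  have {}H : \forall y \near (0 : V), `|F (x + y) - F x - L y| <= e * `|y|.
    apply: filterS H => y; rewrite /= !fctE /= opprD addrA (addrC y x).
    exact.
  near=> y; split; last by near: y.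
    apply: r1P; rewrite /ball_ /= opprD addrA subrr sub0r normrN.
    by near: y; exact: nbhs0_lt.
move=> /nbhs_normP[r /= r0 rP].
have rP' y : `|y| < r -> differentiable g (x + y) /\
    `|F (x + y) - F x - L y| <= e * `|y|.
  by move=> yr; apply: rP; rewrite /ball_ /= sub0r normrN.
near=> h.
have h0 : 0 < h by near: h; exact: nbhs_right_gt.
(* The summand 1 makes the factor positive even for u = v = 0, and the later bound by r strict. *)
have hr : h * (`|u| + `|v| + 1) < r.
  rewrite -ltr_pdivlMr ?ltr_wpDl ?addr_ge0 //.
  near: h; apply: nbhs_right_lt; rewrite divr_gt0 // ltr_wpDl ?addr_ge0 //.
have small s t : 0 <= s <= h -> 0 <= t <= h ->
    `|s *: v + t *: u| <= h * (`|u| + `|v|).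
  move=> /andP[s0 sh] /andP[t0 th]; rewrite (le_trans (ler_normD _ _)) //.
  by rewrite !normrZ !ger0_norm // addrC mulrDr lerD // ler_wpM2r.
have small' s t : 0 <= s <= h -> 0 <= t <= h -> `|s *: v + t *: u| < r.
  move=> sh th; rewrite (le_lt_trans (small _ _ sh th)) // (lt_trans _ hr) //.
  by rewrite ltr_pM2l // ltrDl.
have z : 0 <= (0 : R) <= h by rewrite lexx ltW.
have hh : 0 <= h <= h by rewrite lexx ltW.
have [||t th ->] := @second_difference_mvt g x u v h => //.
  move=> s sh; split.
    by have := (rP' _ (small' 0 s z sh)).1; rewrite scale0r add0r.
  by rewrite -addrA; exact: (rP' _ (small' h s hh sh)).1.
rewrite mulrA -mulrBl normrM (gtr0_norm h0) !mulrA ler_wpM2r ?(ltW h0) //.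
have := (rP' _ (small' h t hh th)).2; have := (rP' _ (small' 0 t z th)).2.
rewrite scale0r add0r !addrA -/F => b0 b1.
have -> : 'D_v F x * h = L (h *: v + t *: u) - L (t *: u).
  by rewrite linearD addrK linearZ /= /L deriveE //= [RHS]mulrC.
have n0 : `|t *: u| <= h * `|u|.
  by case/andP: th => t0 th; rewrite normrZ ger0_norm // ler_wpM2r.
have n1 := small h t hh th.
have m0 : e * `|t *: u| <= e * (h * `|u|) by rewrite ler_wpM2l // ltW.
have m1 : e * `|h *: v + t *: u| <= e * (h * (`|u| + `|v|)).
  by rewrite ler_wpM2l // ltW.
rewrite -(mulrA e); set A := F (_ + _) in b1 *; set B := F (_ + _) in b0 *.
have := ler_normB (A - F x - L (h *: v + t *: u)) (B - F x - L (t *: u)).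
rewrite (_ : A - F x - L (h *: v + t *: u) - (B - F x - L (t *: u)) =
  A - B - (L (h *: v + t *: u) - L (t *: u))); last by lra.
move=> /le_trans; apply.
rewrite (le_trans (lerD b1 b0)) // (le_trans (lerD m1 m0)) //.
by rewrite le_eqVlt; apply/orP; left; apply/eqP; ring.
Unshelve. all: by end_near. Qed.

(** The second difference is symmetric in u and v, and its quotient by h^2 is close to both iterated
    derivatives. *)
Theorem derive_symmetric g x u v :
  (\forall y \near x, differentiable g y) ->
  differentiable ('D_u g) x -> differentiable ('D_v g) x ->
  'D_u ('D_v g) x = 'D_v ('D_u g) x.
Proof.
move=> dg du dv; apply/eqP; rewrite -subr_eq0 -normr_le0; apply/ler_addgt0Pr => e e0.
rewrite add0r.
(* C adds the constants of the two estimates; the final 1 makes it positive, so that e / C is an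
   admissible precision. *)
pose C : R := (`|u| + `|u| + `|v|) + (`|v| + `|v| + `|u|) + 1.
have C0 : 0 < C by rewrite /C ltr_wpDl // !addr_ge0.
have eC : 0 < e / C by rewrite divr_gt0.
have Hu := second_difference_approx v dg du eC.
have Hv := second_difference_approx u dg dv eC.
suff [h [h0 hu hv]] : exists h, [/\ 0 < h,
  `|second_difference g x u v h - 'D_v ('D_u g) x * (h * h)|
      <= e / C * (`|u| + `|u| + `|v|) * (h * h) &
  `|second_difference g x v u h - 'D_u ('D_v g) x * (h * h)|
      <= e / C * (`|v| + `|v| + `|u|) * (h * h)].
  have hh : 0 < h * h by rewrite mulr_gt0.
  rewrite -(ler_pM2r hh) -[X in _ * X <= _](gtr0_norm hh) -normrM.
  have E : second_difference g x v u h = second_difference g x u v h.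
    rewrite /second_difference [x + h *: v + _]addrAC; congr (_ + _).
    by rewrite [LHS]addrAC.
  rewrite E in hv; clear Hu Hv eC; rewrite {}/C in C0 hu hv *.
  move: ('D_v ('D_u g) x) ('D_u ('D_v g) x) (second_difference g x u v h) hu hv.
  move=> a b s hu hv.
  have -> : (b - a) * (h * h) = s - a * (h * h) - (s - b * (h * h)) by ring.
  rewrite (le_trans (ler_normB _ _)) // (le_trans (lerD hu hv)) //.
  rewrite -mulrDl -mulrDr ler_pM2r // mulrAC ler_pdivrMr //.
  by rewrite ler_pM2l // lerDl.
near (0 : R)^'+ => h; exists h; split.
- by near: h; exact: nbhs_right_gt.
- by near: h.
- by near: h.
Unshelve. all: by end_near. Qed.

End Schwarz.

(** * Wirtinger calculus *)

Section ComplexCalculus.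
Variables (R : realType) (n : nat).
Local Notation V := (cspace R n).
Local Notation Re := complex.Re.
Local Notation Im := complex.Im.
Implicit Types (f g : V -> R[i]) (x v : V) (U : set V) (a b : clabel n).

Definition cdiff f x : Prop :=
  differentiable (fun y => Re (f y)) x /\ differentiable (fun y => Im (f y)) x.

Lemma complexReD (z w : R[i]) : Re (z + w) = Re z + Re w.
Proof. by case: z w => [? ?] [? ?]. Qed.
Lemma complexImD (z w : R[i]) : Im (z + w) = Im z + Im w.
Proof. by case: z w => [? ?] [? ?]. Qed.
Lemma complexReM (z w : R[i]) : Re (z * w) = Re z * Re w - Im z * Im w.
Proof. by case: z w => [? ?] [? ?]. Qed.
Lemma complexImM (z w : R[i]) : Im (z * w) = Re z * Im w + Im z * Re w.
Proof. by case: z w => [? ?] [? ?]. Qed.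
Lemma eq_ReIm (z w : R[i]) : Re z = Re w -> Im z = Im w -> z = w.
Proof. by case: z w => [? ?] [? ?] /= -> ->. Qed.

Lemma cdiff_cst (c : R[i]) x : cdiff (fun=> c) x.
Proof. by split; exact: differentiable_cst. Qed.

Lemma cdiffD f g x : cdiff f x -> cdiff g x -> cdiff (fun y => f y + g y) x.
Proof.
move=> [f1 f2] [g1 g2]; split.
  by under eq_fun do rewrite complexReD; exact: differentiableD.
by under eq_fun do rewrite complexImD; exact: differentiableD.
Qed.

Lemma cdiffM f g x : cdiff f x -> cdiff g x -> cdiff (fun y => f y * g y) x.
Proof.
move=> [f1 f2] [g1 g2]; split.
  under eq_fun do rewrite complexReM.
  by apply: differentiableB; exact: differentiableM.
under eq_fun do rewrite complexImM.
by apply: differentiableD; exact: differentiableM.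
Qed.

Lemma cdiff_sum I (r : seq I) (F : I -> V -> R[i]) x :
  (forall i, cdiff (F i) x) -> cdiff (fun y => \sum_(i <- r) F i y) x.
Proof.
move=> dF; elim: r => [|i r IH].
  by under eq_fun do rewrite big_nil; exact: cdiff_cst.
by under eq_fun do rewrite big_cons; exact: cdiffD.
Qed.

Lemma cderive_cst v (c : R[i]) x : cderive v (fun=> c) x = 0.
Proof. by rewrite /cderive !derive_cst. Qed.

Lemma cderiveD v f g x : cdiff f x -> cdiff g x ->
  cderive v (fun y => f y + g y) x = cderive v f x + cderive v g x.
Proof.
move=> [f1 f2] [g1 g2]; apply: eq_ReIm; rewrite ?(complexReD, complexImD) /=.
  under eq_fun do rewrite complexReD.
  by rewrite deriveD //; exact: diff_derivable.
under eq_fun do rewrite complexImD.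
by rewrite deriveD //; exact: diff_derivable.
Qed.

(** Real and imaginary parts of a product both have this shape, with c = -1 and c = 1. *)
Lemma derive_mulDmul (p q r s : V -> R) (c : R) v x :
  derivable p x v -> derivable q x v -> derivable r x v -> derivable s x v ->
  'D_v (fun y => p y * q y + c * (r y * s y)) x =
  ('D_v p x * q x + p x * 'D_v q x) + c * ('D_v r x * s x + r x * 'D_v s x).
Proof.
move=> dp dq dr ds.
have -> : (fun y => p y * q y + c * (r y * s y)) = p * q + c *: (r * s) by [].
have h1 := derivableM dp dq; have h2 := derivableM dr ds.
apply: (etrans (deriveD h1 (derivableZ h2))); congr (_ + _).
  by rewrite (deriveM dp dq) addrC mulrC.
apply: (etrans (deriveZ _ h2)); congr (_ *: _).
by rewrite (deriveM dr ds) addrC mulrC.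
Qed.

Lemma cderiveM v f g x : cdiff f x -> cdiff g x ->
  cderive v (fun y => f y * g y) x = cderive v f x * g x + f x * cderive v g x.
Proof.
move=> [f1 f2] [g1 g2].
have D h : differentiable h x -> derivable h x v by exact: diff_derivable.
apply: eq_ReIm; rewrite ?(complexReD, complexImD, complexReM, complexImM) /=.
  under eq_fun do rewrite complexReM -mulN1r.
  rewrite derive_mulDmul; [|exact: diff_derivable..].
  by rewrite mulN1r opprD addrACA.
under eq_fun do rewrite complexImM -[X in _ + X]mul1r.
rewrite derive_mulDmul; [|exact: diff_derivable..].
by rewrite mul1r addrACA.
Qed.

Lemma cderive_conj v f x : cdiff f x ->
  cderive v (fun y => (f y)^*%C) x = ((cderive v f x)^*)%C.
Proof.
move=> [f1 f2]; rewrite /cderive.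
have -> : (fun y => Re (f y)^*%C) = (fun y => Re (f y)).
  by apply/funext => y; case: (f y).
have -> : (fun y => Im (f y)^*%C) = (fun y => - Im (f y)).
  by apply/funext => y; case: (f y).
by rewrite deriveN //; exact: diff_derivable.
Qed.

Lemma cderive_near v f g x :
  (\forall y \near x, f y = g y) -> cderive v f x = cderive v g x.
Proof.
move=> fg; rewrite /cderive; congr (_ +i* _)%C.
  by apply: near_eq_derive; apply: filterS fg => y ->.
by apply: near_eq_derive; apply: filterS fg => y ->.
Qed.

(** Both kinds of Wirtinger derivative become (D_x + sigma D_y) / 2 with sigma = -i or i, so that
    the calculus rules need no case analysis on the label. *)
Definition zdir a : V :=
  match a with inl j | inr j => (delta_mx 0 j, 0) end.
Definition ydir a : V :=
  match a with inl j | inr j => (0, delta_mx 0 j) end.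
Definition ysign a : R[i] := match a with inl j => - 'i%C | inr j => 'i%C end.

Lemma wirtingerE a f x : wirtinger a f x =
  (cderive (zdir a) f x + ysign a * cderive (ydir a) f x) / 2%:R.
Proof. by case: a => j //=; rewrite mulNr. Qed.

Lemma wirtinger_cst a (c : R[i]) x : wirtinger a (fun=> c) x = 0.
Proof. by rewrite wirtingerE !cderive_cst mulr0 addr0 mul0r. Qed.

Lemma wirtingerD a f g x : cdiff f x -> cdiff g x ->
  wirtinger a (fun y => f y + g y) x = wirtinger a f x + wirtinger a g x.
Proof.
move=> df dg; rewrite !wirtingerE (cderiveD _ df dg) (cderiveD _ df dg).
by rewrite -mulrDl mulrDr addrACA.
Qed.

Lemma wirtingerM a f g x : cdiff f x -> cdiff g x ->
  wirtinger a (fun y => f y * g y) x = wirtinger a f x * g x + f x * wirtinger a g x.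
Proof.
move=> df dg; rewrite !wirtingerE (cderiveM _ df dg) (cderiveM _ df dg).
move: (cderive _ f x) (cderive _ f x) (cderive _ g x) (cderive _ g x).
by move: (f x) (g x) (ysign a) => ? ? ? ? ? ? ?; ring.
Qed.

Lemma wirtinger_sum a I (r : seq I) (F : I -> V -> R[i]) x :
  (forall i, cdiff (F i) x) ->
  wirtinger a (fun y => \sum_(i <- r) F i y) x =
  \sum_(i <- r) wirtinger a (F i) x.
Proof.
move=> dF; elim: r => [|i r IH].
  rewrite big_nil; under [X in wirtinger _ X]eq_fun do rewrite big_nil.
  exact: wirtinger_cst.
rewrite big_cons -IH; under [X in wirtinger _ X]eq_fun do rewrite big_cons.
by rewrite wirtingerD //; exact: cdiff_sum.
Qed.

Lemma wirtinger_near a f g x :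
  (\forall y \near x, f y = g y) -> wirtinger a f x = wirtinger a g x.
Proof. by move=> fg; rewrite !wirtingerE !(cderive_near _ fg). Qed.

Lemma wirtinger_on U a f g x : open U -> U x -> (forall y, U y -> f y = g y) ->
  wirtinger a f x = wirtinger a g x.
Proof.
move=> oU Ux fg; apply: wirtinger_near.
by have := open_nbhs_nbhs (conj oU Ux); apply: filterS.
Qed.

Definition cswap a : clabel n := match a with inl j => inr j | inr j => inl j end.

Lemma cswapK : involutive cswap. Proof. by case. Qed.

Lemma wirtinger_conj a f x : cdiff f x ->
  wirtinger a (fun y => (f y)^*%C) x = ((wirtinger (cswap a) f x)^*)%C.
Proof.
move=> df; rewrite !wirtingerE !cderive_conj //.
have -> : ysign a = ((ysign (cswap a))^*)%C.
  by case: a => j /=; apply: eq_ReIm; rewrite /= ?oppr0 ?opprK.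
have -> : zdir (cswap a) = zdir a by case: a.
have -> : ydir (cswap a) = ydir a by case: a.
rewrite [in RHS]rmorphM [in RHS]rmorphD [in RHS]rmorphM.
by rewrite fmorphV rmorph_nat.
Qed.

Lemma ccoord_conj a x : ccoord (cswap a) x = ((ccoord a x)^*)%C.
Proof. by case: a => j /=; apply: eq_ReIm; rewrite /= ?opprK. Qed.

End ComplexCalculus.

(** * The chain rule *)

Section ChainRule.
Variables (R : realType) (n : nat).
Local Notation V := (cspace R n).
Local Notation Re := complex.Re.
Local Notation Im := complex.Im.
Implicit Types (f g : V -> R[i]) (p : V -> R) (phi : V -> V).
Implicit Types (x v h : V) (U : set V) (a b : clabel n).

Lemma derive_basis p h x : differentiable p x ->
  'D_h p x = \sum_j (h.1 ord0 j * 'D_(delta_mx 0 j, 0) p x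
                     + h.2 ord0 j * 'D_(0, delta_mx 0 j) p x).
Proof.
move=> dp.
have hE : h = \sum_j (h.1 ord0 j *: (delta_mx 0 j, 0) +
                      h.2 ord0 j *: (0, delta_mx 0 j)) :> V.
  have E (F : 'I_n -> V) : \sum_j F j = (\sum_j (F j).1, \sum_j (F j).2).
    elim/big_rec3: _ => // j a b c _ ->; by case: (F j).
  rewrite {}E [LHS]surjective_pairing; congr pair; rewrite [LHS]row_sum_delta.
    by apply: eq_bigr => j _; rewrite /= scaler0 addr0.
  by apply: eq_bigr => j _; rewrite /= scaler0 add0r.
rewrite deriveE // [in LHS]hE linear_sum; apply: eq_bigr => j _.
rewrite linearD 2!linearZ !deriveE //=.
Qed.

Lemma complexRe_sum I (r : seq I) (F : I -> R[i]) :
  Re (\sum_(i <- r) F i) = \sum_(i <- r) Re (F i).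
Proof. by apply: big_morph => //; exact: complexReD. Qed.

Lemma complexIm_sum I (r : seq I) (F : I -> R[i]) :
  Im (\sum_(i <- r) F i) = \sum_(i <- r) Im (F i).
Proof. by apply: big_morph => //; exact: complexImD. Qed.

(** This is df = sum_b (df/dw_b) dw_b evaluated at h: the labels [inl j] and [inr j] together
    recombine into the x_j and y_j terms. *)
Lemma cderive_basis f h x : cdiff f x ->
  cderive h f x = \sum_b ccoord b h * wirtinger b f x.
Proof.
move=> [d1 d2]; rewrite big_sumType /= -big_split /=.
have E j : ccoord (inl j) h * wirtinger (inl j) f x +
    ccoord (inr j) h * wirtinger (inr j) f x =
    (h.1 ord0 j)%:C%C * cderive (delta_mx 0 j, 0) f x +
    (h.2 ord0 j)%:C%C * cderive (0, delta_mx 0 j) f x.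
  rewrite /ccoord /wirtinger.
  have -> : (h.1 ord0 j +i* h.2 ord0 j)%C =
      (h.1 ord0 j)%:C%C + 'i%C * (h.2 ord0 j)%:C%C.
    apply: eq_ReIm; rewrite ?(complexReD, complexImD, complexReM, complexImM) /=;
      ring.
  have -> : (h.1 ord0 j -i* h.2 ord0 j)%C =
      (h.1 ord0 j)%:C%C - 'i%C * (h.2 ord0 j)%:C%C.
    apply: eq_ReIm; rewrite ?(complexReD, complexImD, complexReM, complexImM) /=;
      ring.
  move: (cderive _ f x) (cderive _ f x) ((h.1 ord0 j)%:C)%C ((h.2 ord0 j)%:C)%C.
  move=> B A c d; have i2 : 'i%C * 'i%C = - 1 :> R[i].
    by apply: eq_ReIm; rewrite ?(complexReM, complexImM) /=; ring.
  apply: (@etrans _ _ (c * A + - ('i%C * 'i%C) * (d * B))); first by field.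
  by rewrite i2 opprK mul1r.
under eq_bigr do rewrite E.
have ReZ (r : R) (z : R[i]) : Re (r%:C%C * z) = r * Re z.
  by rewrite complexReM mul0r subr0.
have ImZ (r : R) (z : R[i]) : Im (r%:C%C * z) = r * Im z.
  by rewrite complexImM mul0r addr0.
apply: eq_ReIm; rewrite ?(complexRe_sum, complexIm_sum).
  transitivity ('D_h (fun y => Re (f y)) x); first by [].
  rewrite derive_basis //; apply: eq_bigr => j _.
  by rewrite [RHS]complexReD [X in _ = X + _]ReZ [X in _ = _ + X]ReZ.
transitivity ('D_h (fun y => Im (f y)) x); first by [].
rewrite derive_basis //; apply: eq_bigr => j _.
by rewrite [RHS]complexImD [X in _ = X + _]ImZ [X in _ = _ + X]ImZ.
Qed.

Lemma differentiable_rV (u : V -> 'rV[R]_n) x :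
  (forall j, differentiable (fun y => u y ord0 j) x) -> differentiable u x.
Proof.
move=> du.
have -> : u = \sum_j (fun y => u y ord0 j *: delta_mx 0 j).
  by apply/funext => y; rewrite fct_sumE -row_sum_delta.
by apply: differentiable_sum => j; exact: differentiableZl.
Qed.

Section DifferentialOfMap.
Variables (phi : V -> V) (x : V).
Hypothesis dphi : forall b, cdiff (fun y => ccoord b (phi y)) x.

Let d1 : differentiable (fun y => (phi y).1) x.
Proof. by apply: differentiable_rV => j; have [] := dphi (inl j). Qed.

Let d2 : differentiable (fun y => (phi y).2) x.
Proof. by apply: differentiable_rV => j; have [] := dphi (inl j). Qed.

Let phiE : phi = fun y => ((phi y).1, (phi y).2).
Proof. by apply/funext => y; rewrite -surjective_pairing. Qed.

Lemma differentiable_cspace : differentiable phi x.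
Proof. by rewrite phiE; exact: differentiable_pair. Qed.

(** Complex coordinates are R-linear, hence commute with the differential. *)
Lemma ccoord_diff b v :
  ccoord b ('d phi x v) = cderive v (fun y => ccoord b (phi y)) x.
Proof.
have -> : 'd phi x v = ('D_v (fun y => (phi y).1) x, 'D_v (fun y => (phi y).2) x).
  rewrite (deriveE v d1) (deriveE v d2) [in LHS]phiE.
  exact: (congr1 (@^~ v) (diff_pair d1 d2)).
have [dd1 dd2] := (diff_derivable (v := v) d1, diff_derivable (v := v) d2).
case: b => j; apply: eq_ReIm; rewrite /= ?(derive_mx dd1) ?(derive_mx dd2) ?mxE //.
rewrite deriveN //.
by apply: diff_derivable; have [] := dphi (inl j).
Qed.

Lemma cdiff_comp f : cdiff f (phi x) -> cdiff (fun y => f (phi y)) x.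
Proof.
move=> [f1 f2]; split.
  exact: (differentiable_comp differentiable_cspace f1).
exact: (differentiable_comp differentiable_cspace f2).
Qed.

Lemma cderive_comp f v : cdiff f (phi x) ->
  cderive v (fun y => f (phi y)) x =
  \sum_b cderive v (fun y => ccoord b (phi y)) x * wirtinger b f (phi x).
Proof.
move=> df; under eq_bigr do rewrite -ccoord_diff.
rewrite -cderive_basis //; case: df => f1 f2; have dp := differentiable_cspace.
have D (p : V -> R) : differentiable p (phi x) ->
    'D_v (fun y => p (phi y)) x = 'D_('d phi x v) p (phi x).
  move=> dfp; rewrite (deriveE _ dfp).
  apply: (etrans (deriveE v (differentiable_comp dp dfp))).
  exact: (congr1 (@^~ v) (diff_comp dp dfp)).
by apply: eq_ReIm; [exact: (D _ f1)|exact: (D _ f2)].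
Qed.

Lemma wirtinger_comp f a : cdiff f (phi x) ->
  wirtinger a (fun y => f (phi y)) x =
  \sum_b wirtinger a (fun y => ccoord b (phi y)) x * wirtinger b f (phi x).
Proof.
move=> df; rewrite [LHS]wirtingerE (cderive_comp _ df) (cderive_comp _ df).
under [RHS]eq_bigr do rewrite [X in X * _]wirtingerE.
move: (fun b => wirtinger b f (phi x)) => W.
rewrite mulr_sumr -big_split mulr_suml; apply: eq_bigr => b _.
by rewrite /= mulrA -mulrDl mulrAC.
Qed.

End DifferentialOfMap.

End ChainRule.

(** * Smooth functions *)

(** The first-order expansion of f at x also holds for g, and uniqueness of the differential
    identifies its linear part. *)
Lemma near_eq_differentiable (R : numFieldType) (V W : normedModType R)
    (f g : V -> W) (x : V) :
  (\forall y \near x, f y = g y) -> differentiable f x -> differentiable g x.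
Proof.
move=> fg df.
have gx : g x = f x by rewrite (nbhs_singleton fg).
have go : g \o shift x = cst (g x) + 'd f x +o_ 0 id.
  apply/eqaddoP => e e0.
  have /diff_locally/eqaddoP/(_ e e0) H := df.
  have fg' : \forall y \near (0 : V), f (y + x) = g (y + x).
    by move: fg; rewrite (near_shift 0) /= subr0.
  near=> y; rewrite gx !fctE /= -(near fg' y) //.
  near: y; apply: filterS H => y; rewrite !fctE //.
apply/diff_locallyP.
have dfc := diff_continuous df.
by rewrite (diff_unique dfc go); split; [exact: dfc|exact: go].
Unshelve. all: by end_near. Qed.

Section Smooth.
Variables (R : realType) (n : nat).
Local Notation V := (cspace R n).
Local Notation Re := complex.Re.
Local Notation Im := complex.Im.
Variable U : set V.
Hypothesis oU : open U.
Implicit Types (f g : V -> R[i]) (p q : V -> R).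
Implicit Types (x v h : V) (a b : clabel n).

Let near_U x (P : V -> Prop) : U x -> (forall y, U y -> P y) ->
  \forall y \near x, P y.
Proof. by move=> Ux UP; exact: (filterS UP (open_nbhs_nbhs (conj oU Ux))). Qed.

(** Values off U are arbitrary; equality on U passes to derivatives because U is open. *)
Lemma times_differentiable_ext k p q : (forall x, U x -> p x = q x) ->
  times_differentiable k U p -> times_differentiable k U q.
Proof.
elim: k p q => [//|k IH] p q pq /= [dp dpk]; split=> [x Ux|v].
  exact: near_eq_differentiable (near_U Ux pq) (dp x Ux).
by apply: IH (dpk v) => x Ux; apply: near_eq_derive; exact: near_U Ux pq.
Qed.

Lemma times_differentiable_cst k (c : R) : times_differentiable k U (fun=> c).
Proof.
elim: k c => [//|k IH] c /=; split=> [x _|v]; first exact: differentiable_cst.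
have -> : 'D_v (fun=> c) = (fun=> 0); last exact: IH.
by apply/funext => x; exact: derive_cst.
Qed.

Lemma times_differentiableD k p q : times_differentiable k U p ->
  times_differentiable k U q -> times_differentiable k U (fun x => p x + q x).
Proof.
elim: k p q => [//|k IH] p q /= [dp dpk] [dq dqk]; split=> [x Ux|v].
  exact: differentiableD (dp x Ux) (dq x Ux).
apply: times_differentiable_ext (IH _ _ (dpk v) (dqk v)) => x Ux.
by apply/esym/deriveD; apply: diff_derivable; [exact: dp|exact: dq].
Qed.

Lemma times_differentiableZ k (c : R) p : times_differentiable k U p ->
  times_differentiable k U (fun x => c * p x).
Proof.
elim: k p => [//|k IH] p /= [dp dpk]; split=> [x Ux|v].
  exact: differentiableZ (dp x Ux).
apply: times_differentiable_ext (IH _ (dpk v)) => x Ux.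
by apply/esym/deriveZ; apply: diff_derivable; exact: dp.
Qed.

Lemma smooth_on_cdiff f x : smooth_on U f -> U x -> cdiff f x.
Proof.
by move=> sf Ux; have [[d1 _] [d2 _]] := sf 1; split; [exact: d1|exact: d2].
Qed.

Lemma smooth_on_ext f g : (forall x, U x -> f x = g x) ->
  smooth_on U f -> smooth_on U g.
Proof.
move=> fg sf k; have [d1 d2] := sf k.
by split; [apply: times_differentiable_ext d1|apply: times_differentiable_ext d2];
  move=> x Ux; rewrite fg.
Qed.

Lemma smooth_on_cst (c : R[i]) : smooth_on U (fun=> c).
Proof. by move=> k; split; exact: times_differentiable_cst. Qed.

Lemma smooth_onD f g : smooth_on U f -> smooth_on U g ->
  smooth_on U (fun x => f x + g x).
Proof.
move=> sf sg k; have [f1 f2] := sf k; have [g1 g2] := sg k.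
split.
  by under eq_fun do rewrite complexReD; exact: times_differentiableD.
by under eq_fun do rewrite complexImD; exact: times_differentiableD.
Qed.

Lemma smooth_onZ (c : R[i]) f : smooth_on U f -> smooth_on U (fun x => c * f x).
Proof.
move=> sf k; have [f1 f2] := sf k; split.
  under eq_fun do rewrite complexReM -mulNr.
  by apply: times_differentiableD; exact: times_differentiableZ.
under eq_fun do rewrite complexImM.
by apply: times_differentiableD; exact: times_differentiableZ.
Qed.

Lemma smooth_on_conj f : smooth_on U f -> smooth_on U (fun x => (f x)^*%C).
Proof.
move=> sf k; have [f1 f2] := sf k; split.
  by apply: times_differentiable_ext f1 => x _; case: (f x).
apply: times_differentiable_ext (times_differentiableZ (-1) f2) => x _.
by case: (f x) => ? ? /=; rewrite mulN1r.
Qed.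

Lemma smooth_on_sum I (r : seq I) (F : I -> V -> R[i]) :
  (forall i, smooth_on U (F i)) -> smooth_on U (fun x => \sum_(i <- r) F i x).
Proof.
move=> sF; elim: r => [|i r IH].
  by under eq_fun do rewrite big_nil; exact: smooth_on_cst.
by under eq_fun do rewrite big_cons; exact: smooth_onD.
Qed.

Lemma smooth_on_cderive v f : smooth_on U f -> smooth_on U (cderive v f).
Proof.
by move=> sf k; have [[_ d1] [_ d2]] := sf k.+1; split; [exact: d1|exact: d2].
Qed.

Lemma smooth_on_wirtinger a f : smooth_on U f -> smooth_on U (wirtinger a f).
Proof.
move=> sf.
have -> : wirtinger a f = fun x => 2%:R^-1 *
    (cderive (zdir R a) f x + ysign R a * cderive (ydir R a) f x).
  by apply/funext => x; rewrite wirtingerE mulrC.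
apply: smooth_onZ; apply: smooth_onD; first exact: smooth_on_cderive.
by apply: smooth_onZ; exact: smooth_on_cderive.
Qed.

Lemma cderiveC u v f x : smooth_on U f -> U x ->
  cderive u (cderive v f) x = cderive v (cderive u f) x.
Proof.
move=> sf Ux; have [[d1 dd1] [d2 dd2]] := sf 2.
by apply: eq_ReIm; apply: derive_symmetric;
  [exact: near_U Ux d1|case: (dd1 u) => + _; exact|case: (dd1 v) => + _; exact
  |exact: near_U Ux d2|case: (dd2 u) => + _; exact|case: (dd2 v) => + _; exact].
Qed.

Let wirtinger_fun a f : wirtinger a f =
  fun x => (cderive (zdir R a) f x + ysign R a * cderive (ydir R a) f x) * 2%:R^-1.
Proof. by apply/funext => x; rewrite wirtingerE. Qed.

Lemma cderive_lin v (s c : R[i]) f g x : cdiff f x -> cdiff g x ->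
  cderive v (fun y => (f y + s * g y) * c) x =
  (cderive v f x + s * cderive v g x) * c.
Proof.
move=> df dg; have ds := cdiff_cst s x; have dc := cdiff_cst c x.
have dsg := cdiffM ds dg.
rewrite (cderiveM v (cdiffD df dsg) dc) (cderiveD v df dsg) (cderiveM v ds dg).
by rewrite !cderive_cst mulr0 mul0r addr0 add0r.
Qed.

Lemma cderive_wirtinger v a f x : smooth_on U f -> U x ->
  cderive v (wirtinger a f) x = wirtinger a (cderive v f) x.
Proof.
move=> sf Ux; rewrite [in LHS]wirtinger_fun [RHS]wirtingerE.
have D h : cdiff (cderive h f) x.
  by apply: smooth_on_cdiff Ux; exact: smooth_on_cderive.
apply: (etrans (cderive_lin v _ _ (D (zdir R a)) (D (ydir R a)))).
exact: (f_equal2 (fun z w => (z + ysign R a * w) * 2%:R^-1)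
  (cderiveC v (zdir R a) sf Ux) (cderiveC v (ydir R a) sf Ux)).
Qed.

(** Wirtinger derivatives are combinations of directional ones with constant coefficients and
    inherit their symmetry. *)
Lemma wirtingerC a b f x : smooth_on U f -> U x ->
  wirtinger a (wirtinger b f) x = wirtinger b (wirtinger a f) x.
Proof.
move=> sf Ux; have D h : cdiff (cderive h f) x.
  by apply: smooth_on_cdiff Ux; exact: smooth_on_cderive.
have ds := cdiff_cst (ysign R a) x; have dc := cdiff_cst (2%:R^-1 : R[i]) x.
have dsg := cdiffM ds (D (ydir R a)).
rewrite [LHS]wirtingerE (cderive_wirtinger _ _ sf Ux) (cderive_wirtinger _ _ sf Ux).
apply: esym; rewrite [in LHS](wirtinger_fun a f).
apply: (etrans (wirtingerM b (cdiffD (D (zdir R a)) dsg) dc)).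
rewrite wirtinger_cst mulr0 addr0; apply: (congr1 (fun z => z * 2%:R^-1)).
apply: (etrans (wirtingerD b (D (zdir R a)) dsg)).
apply: (congr1 (fun z => wirtinger b (cderive (zdir R a) f) x + z)).
apply: (etrans (wirtingerM b ds (D (ydir R a)))).
by rewrite wirtinger_cst mul0r add0r.
Qed.

End Smooth.

(** * Forms in a chart *)

Section ChartForms.
Variables (R : realType) (n : nat).
Local Notation V := (cspace R n).
Local Notation L := (clabel n).
Local Notation cforms := (seq L -> V -> R[i]).
Implicit Types (W : cforms) (P Q : pred L) (x : V) (a b c e : L) (s t : seq L).
Implicit Types (U : set V).

Local Opaque wirtinger.

(** The formula of [partial_d] in a single chart without the cut-off, so that the recursion on
    labels holds at every point. *)
Definition chart_d P W : cforms := fun s x =>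
  \sum_(l < size s | P (tnth (in_tuple s) l))
    (-1) ^+ l *
    wirtinger (tnth (in_tuple s) l) (W (take l s ++ drop l.+1 s)) x.

Definition contract a W : cforms := fun s => W (a :: s).

Definition alternating W : Prop := forall s1 a b s2 x,
  W (s1 ++ [:: a, b & s2]) x = - W (s1 ++ [:: b, a & s2]) x.

Definition smooth_form U W : Prop := forall s, smooth_on U (W s).

Definition lincomb (k l : R[i]) W1 W2 : cforms := fun s x =>
  k * W1 s x + l * W2 s x.

Lemma chart_d_nil P W x : chart_d P W [::] x = 0.
Proof. by rewrite /chart_d big_ord0. Qed.

(** The head label gives the summand l = 0; deleting a later label leaves the head in place and
    costs one more sign. Thus iota_a d_P = P(a) D_a - d_P iota_a. *)
Lemma chart_d_cons P W a s x : chart_d P W (a :: s) x =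
  (P a)%:R * wirtinger a (W s) x - chart_d P (contract a W) s x.
Proof.
rewrite /chart_d big_mkcond big_ord_recl [in RHS]big_mkcond /=.
rewrite {1 2}(tnth_nth a) /= drop0 expr0 mul1r; congr (_ + _).
  by case: (P a); rewrite ?mul1r ?mul0r.
rewrite -sumrN; apply: eq_bigr => l _.
rewrite !(tnth_nth a) /=; case: (P _); last by rewrite oppr0.
by rewrite add0n exprS mulN1r mulNr.
Qed.

Lemma wirtinger_lin a (k l : R[i]) (f g : V -> R[i]) x : cdiff f x -> cdiff g x ->
  wirtinger a (fun y => k * f y + l * g y) x =
  k * wirtinger a f x + l * wirtinger a g x.
Proof.
move=> df dg; have dk := cdiff_cst k x; have dl := cdiff_cst l x.
apply: (etrans (wirtingerD a (cdiffM dk df) (cdiffM dl dg))).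
rewrite (wirtingerM a dk df) (wirtingerM a dl dg) !wirtinger_cst.
by move: (wirtinger a f x) (wirtinger a g x) => *; rewrite !mul0r !add0r.
Qed.

Lemma chart_d_lin P k l W1 W2 s x :
  (forall t, cdiff (W1 t) x) -> (forall t, cdiff (W2 t) x) ->
  chart_d P (lincomb k l W1 W2) s x = k * chart_d P W1 s x + l * chart_d P W2 s x.
Proof.
elim: s W1 W2 => [|a s IH] W1 W2 d1 d2; first by rewrite !chart_d_nil; ring.
rewrite !chart_d_cons wirtinger_lin //.
rewrite (IH (contract a W1) (contract a W2)); first last.
- by move=> t; exact: d2.
- by move=> t; exact: d1.
move: (wirtinger _ _ _) (wirtinger _ _ _) (chart_d _ _ _ _) (chart_d _ _ _ _).
by move: ((P a)%:R) => *; ring.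
Qed.

Lemma chart_d_on P U W1 W2 s x : open U -> U x ->
  (forall t y, U y -> W1 t y = W2 t y) -> chart_d P W1 s x = chart_d P W2 s x.
Proof.
move=> oU Ux E; apply: eq_bigr => l _; congr (_ * _).
by apply: (wirtinger_on _ oU Ux) => y; exact: E.
Qed.

Lemma chart_d_smooth P U W : open U -> smooth_form U W ->
  smooth_form U (chart_d P W).
Proof.
move=> oU sW s; rewrite /chart_d; under eq_fun do rewrite big_mkcond.
apply: (smooth_on_sum oU) => l; case: (P _); last exact: smooth_on_cst.
by apply: smooth_onZ => //; exact: smooth_on_wirtinger.
Qed.

Section Smooth.
Variables (U : set V) (x : V).
Hypotheses (oU : open U) (Ux : U x).

Let smooth_cdiff W : smooth_form U W -> forall t, cdiff (W t) x.
Proof. by move=> sW t; exact: smooth_on_cdiff (sW t) Ux. Qed.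

Lemma smooth_wirtinger_form a W : smooth_form U W ->
  smooth_form U (fun t => wirtinger a (W t)).
Proof. by move=> sW t; exact: smooth_on_wirtinger. Qed.

Lemma contract_chart_d P W a :
  contract a (chart_d P W) =
  lincomb (P a)%:R (-1) (fun t => wirtinger a (W t)) (chart_d P (contract a W)).
Proof.
apply/funext => t; apply/funext => y.
by rewrite /contract /lincomb chart_d_cons mulN1r.
Qed.

Lemma wirtinger_chart_d P W a s : smooth_form U W ->
  wirtinger a (chart_d P W s) x = chart_d P (fun t => wirtinger a (W t)) s x.
Proof.
elim: s W => [|b s IH] W sW.
  rewrite chart_d_nil; have -> : chart_d P W [::] = fun=> 0.
    by apply/funext => y; exact: chart_d_nil.
  exact: wirtinger_cst.
have sW' : smooth_form U (contract b W) by move=> t; exact: sW.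
rewrite -[chart_d P W (b :: s)]/(contract b (chart_d P W) s) contract_chart_d.
rewrite wirtinger_lin; first last.
- exact: smooth_cdiff (chart_d_smooth P oU sW') s.
- exact: smooth_cdiff (smooth_wirtinger_form b sW) s.
rewrite (wirtingerC oU a b (sW s) Ux) (IH _ sW') chart_d_cons mulN1r.
by [].
Qed.

(** Two predicates give the squares of d, del and delbar and the anticommutation of del with delbar
    at once. Under iota_a the terms P(a) D_a d_Q and P(a) d_Q D_a cancel, likewise with P and Q
    exchanged, and the claim for iota_a W remains. *)
Lemma chart_d_anticomm P Q W s : smooth_form U W ->
  chart_d P (chart_d Q W) s x + chart_d Q (chart_d P W) s x = 0.
Proof.
elim: s W => [|a s IH] W sW; first by rewrite !chart_d_nil addr0.
have sW' : smooth_form U (contract a W) by move=> t; exact: sW.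
rewrite !chart_d_cons !contract_chart_d.
have sa := smooth_wirtinger_form a sW.
have da := smooth_cdiff sa.
rewrite (chart_d_lin _ _ _ _ da (smooth_cdiff (chart_d_smooth Q oU sW'))).
rewrite (chart_d_lin _ _ _ _ da (smooth_cdiff (chart_d_smooth P oU sW'))).
rewrite (wirtinger_chart_d Q a s sW) (wirtinger_chart_d P a s sW).
have := IH _ sW'.
move: (chart_d P (chart_d Q _) s x) (chart_d Q (chart_d P _) s x) => u v.
move: (chart_d _ _ s x) (chart_d _ _ s x) (P a)%:R (Q a)%:R => u' v' p q E.
by rewrite -E; ring.
Qed.

End Smooth.

Lemma contract_alternating a W : alternating W -> alternating (contract a W).
Proof. by move=> aW s1 b c s2 x; exact: (aW (a :: s1)). Qed.

Lemma wirtingerN a (f : V -> R[i]) x : cdiff f x ->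
  wirtinger a (fun y => - f y) x = - wirtinger a f x.
Proof.
move=> df; have dk := cdiff_cst (-1 : R[i]) x.
under eq_fun do rewrite -mulN1r.
by rewrite (wirtingerM a dk df) wirtinger_cst mul0r add0r mulN1r.
Qed.

Lemma chart_dN P W s x : (forall t, cdiff (W t) x) ->
  chart_d P (fun t y => - W t y) s x = - chart_d P W s x.
Proof.
move=> dW; rewrite /chart_d -sumrN; apply: eq_bigr => l _.
by rewrite wirtingerN // mulrN.
Qed.

(** At the head of the list, the two derivative terms are exchanged with opposite signs, and the
    third is d_P iota_b iota_a W, antisymmetric because W alternates. *)
Lemma chart_d_alternating P U W s1 a b s2 x : alternating W ->
  smooth_form U W -> U x ->
  chart_d P W (s1 ++ [:: a, b & s2]) x = - chart_d P W (s1 ++ [:: b, a & s2]) x.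
Proof.
move=> aW sW Ux.
have dW t : cdiff (W t) x by exact: smooth_on_cdiff (sW t) Ux.
elim: s1 W aW {sW} dW => [|c s1 IH] W aW dW.
  rewrite !cat0s !chart_d_cons.
  have -> : contract a (contract b W) = fun t y => - contract b (contract a W) t y.
    apply/funext => t; apply/funext => y; exact: (aW [::]).
  rewrite chart_dN; last by move=> t; exact: dW.
  rewrite /contract.
  move: (wirtinger _ _ _) (wirtinger _ _ _) (chart_d _ _ _ _).
  by move: (P a)%:R (P b)%:R => *; ring.
rewrite !cat_cons !chart_d_cons (IH (contract c W)); first last.
- by move=> t; exact: dW.
- exact: contract_alternating.
have -> : W (s1 ++ [:: a, b & s2]) = fun y => - W (s1 ++ [:: b, a & s2]) y.
  by apply/funext => y; exact: aW.
by rewrite wirtingerN // mulrN opprD.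
Qed.

(** * Pullback of forms along a smooth map *)

Section Pullback.
Variable phi : V -> V.

Definition jac a b : V -> R[i] := wirtinger a (fun y => ccoord b (phi y)).

Fixpoint pull W s : V -> R[i] :=
  if s is a :: s' then fun x => \sum_b jac a b x * pull (contract b W) s' x
  else fun x => W [::] (phi x).

(** Links the recursion to the sum over tuples in the transformation law of forms: a tuple is a
    head, summed first, and a tail. *)
Lemma pullE W s x : pull W s x =
  \sum_(t : (size s).-tuple L)
    (\prod_(k < size s) jac (tnth (in_tuple s) k) (tnth t k) x) * W t (phi x).
Proof.
elim: s W => [|a s IH] W /=.
  rewrite (big_pred1 [tuple]) ?big_ord0 ?mul1r // => t.
  by apply/esym/eqP; exact: tuple0.
under eq_bigr do rewrite IH mulr_sumr.
rewrite pair_bigA /=.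
rewrite (reindex (fun bt : L * (size s).-tuple L =>
  cons_tuple bt.1 bt.2)) /=; last first.
  exists (fun t : (size s).+1.-tuple L => (thead t, behead_tuple t)) => t _.
    by case: t => b t /=; congr pair; apply: val_inj.
  by apply: val_inj; rewrite [in RHS](tuple_eta t).
apply: eq_bigr => -[b t] _ /=; rewrite big_ord_recl /= mulrA /contract.
apply: (congr1 (fun z => jac a b x * z * W (b :: t) (phi x))).
by apply: eq_bigr => k _; rewrite !(tnth_nth b).
Qed.

Lemma pull_lin k l W1 W2 s x :
  pull (lincomb k l W1 W2) s x = k * pull W1 s x + l * pull W2 s x.
Proof.
elim: s W1 W2 => [//|a s IH] W1 W2 /=.
rewrite !mulr_sumr -big_split; apply: eq_bigr => b _ /=.
rewrite (IH (contract b W1) (contract b W2)); ring.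
Qed.

Lemma pull_ext W1 W2 s x : (forall t, W1 t (phi x) = W2 t (phi x)) ->
  pull W1 s x = pull W2 s x.
Proof.
elim: s W1 W2 => [|a s IH] W1 W2 E /=; first exact: E.
by apply: eq_bigr => b _; rewrite (IH _ (contract b W2)) // => t; exact: E.
Qed.

Lemma pullN W s x : pull (fun t y => - W t y) s x = - pull W s x.
Proof.
elim: s W => [//|a s IH] W /=; rewrite -sumrN; apply: eq_bigr => b _.
by rewrite -mulrN -IH.
Qed.

(** The exterior product of a 1-form alpha with A, through iota_a (alpha /\ A) = alpha_a A - alpha
    /\ iota_a A. *)
Fixpoint wedge (alpha : L -> R[i]) (A : seq L -> R[i]) s : R[i] :=
  if s is a :: s' then alpha a * A s' - wedge alpha (fun t => A (a :: t)) s'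
  else 0.

Lemma wedge_sum I (r : seq I) (k : I -> R[i]) alpha (A : I -> seq L -> R[i]) s :
  wedge alpha (fun t => \sum_(i <- r) k i * A i t) s =
  \sum_(i <- r) k i * wedge alpha (A i) s.
Proof.
elim: s A => [|a s IH] A /=; first by rewrite big1 // => i _; rewrite mulr0.
rewrite (IH (fun i t => A i (a :: t))) mulr_sumr -sumrB.
by apply: eq_bigr => i _; rewrite mulrBr mulrCA.
Qed.

Lemma wedgeN alpha (A : seq L -> R[i]) s :
  wedge alpha (fun t => - A t) s = - wedge alpha A s.
Proof.
elim: s A => [|a s IH] A /=; first by rewrite oppr0.
by rewrite (IH (fun t => A (a :: t))) mulrN opprD.
Qed.

Variables (U U' : set V).
Hypotheses (oU : open U) (phiU : forall x, U x -> U' (phi x)).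
Hypothesis sphi : forall b, smooth_on U (fun y => ccoord b (phi y)).

Let cdiff_jac a b x : U x -> cdiff (jac a b) x.
Proof. by move=> Ux; apply: smooth_on_cdiff Ux; exact: smooth_on_wirtinger. Qed.

Lemma cdiff_pull W s x : smooth_form U' W -> U x -> cdiff (pull W s) x.
Proof.
move=> sW Ux; elim: s W sW => [|a s IH] W sW /=.
  apply: cdiff_comp; last exact: smooth_on_cdiff (sW _) (phiU Ux).
  by move=> b; exact: smooth_on_cdiff Ux.
apply: cdiff_sum => b; apply: cdiffM; first exact: cdiff_jac.
by apply: IH => t; exact: sW.
Qed.

Lemma jacC a b c x : U x -> wirtinger a (jac c b) x = wirtinger c (jac a b) x.
Proof. by move=> Ux; exact: (wirtingerC oU a c (sphi b) Ux). Qed.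

(* The sums involving derivatives of J match because W alternates, that is,
   iota_e iota_b W = - iota_b iota_e W. *)
Lemma wirtinger_pull W a s x : alternating W -> smooth_form U' W -> U x ->
  wirtinger a (pull W s) x =
  \sum_b wedge (fun c => wirtinger c (jac a b) x)
               (fun t => pull (contract b W) t x) s +
  \sum_b jac a b x * pull (fun t => wirtinger b (W t)) s x.
Proof.
move=> + + Ux; elim: s W => [|c s IH] W aW sW.
  rewrite /= big1 // add0r; apply: wirtinger_comp.
    by move=> b; exact: smooth_on_cdiff Ux.
  exact: smooth_on_cdiff (sW _) (phiU Ux).
have sW' b : smooth_form U' (contract b W) by move=> t; exact: sW.
have dp b : cdiff (pull (contract b W) s) x by exact: cdiff_pull.
have -> : wirtinger a (pull W (c :: s)) x =
    \sum_b (wirtinger c (jac a b) x * pull (contract b W) s x +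
            jac c b x * wirtinger a (pull (contract b W) s) x).
  rewrite /= wirtinger_sum; last by move=> b; apply: cdiffM => //; exact: cdiff_jac.
  apply: eq_bigr => b _.
  by rewrite (wirtingerM a (cdiff_jac c b Ux) (dp b)) (jacC a b c Ux).
under eq_bigr do rewrite (IH _ (contract_alternating _ aW) (sW' _)).
rewrite /= big_split sumrB /= -addrA; congr (_ + _).
under eq_bigr do rewrite mulrDr !mulr_sumr.
rewrite big_split /=; congr (_ + _).
  rewrite exchange_big -sumrN; apply: eq_bigr => b _ /=.
  rewrite (wedge_sum _ (jac c ^~ x) _
    (fun e t => pull (contract e (contract b W)) t x)).
  rewrite -sumrN; apply: eq_bigr => e _; rewrite -mulrN -wedgeN.
  congr (_ * wedge _ _ _); apply/funext => t; rewrite -pullN.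
  congr (pull _ t x); apply/funext => r; apply/funext => y.
  exact: (aW [::] e b r y).
rewrite exchange_big; apply: eq_bigr => b _ /=.
by rewrite mulr_sumr; apply: eq_bigr => e _; rewrite mulrCA.
Qed.

Lemma chart_d_sum P I (r : seq I) (F : I -> cforms) s x :
  (forall i t, cdiff (F i t) x) ->
  chart_d P (fun t y => \sum_(i <- r) F i t y) s x =
  \sum_(i <- r) chart_d P (F i) s x.
Proof.
move=> dF; rewrite /chart_d exchange_big; apply: eq_bigr => l _ /=.
by rewrite wirtinger_sum // mulr_sumr.
Qed.

(** The Leibniz rule d (J A) = dJ /\ A + J dA for a function J. *)
Lemma chart_d_mul (J : V -> R[i]) (A : cforms) s x :
  cdiff J x -> (forall t, cdiff (A t) x) ->
  chart_d predT (fun t y => J y * A t y) s x =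
  wedge (fun c => wirtinger c J x) (fun t => A t x) s + J x * chart_d predT A s x.
Proof.
move=> dJ; elim: s A => [|a s IH] A dA; first by rewrite !chart_d_nil mulr0 addr0.
rewrite !chart_d_cons (wirtingerM a dJ (dA s)) (IH (contract a A)); last first.
  by move=> t; exact: dA.
rewrite /= /contract.
move: (wirtinger _ J x) (wirtinger _ (A s) x) (wedge _ _ _) (chart_d _ _ _ _).
by move=> *; ring.
Qed.

(** Under iota_a, the terms dJ_ab /\ T iota_b W arise once from D_a T W and once, by Leibniz, from d
    iota_a T W, and cancel. What is left is the sum over b of J_ab T (D_b - d iota_b) W. *)
Theorem chart_d_pull W s x : alternating W -> smooth_form U' W -> U x ->
  chart_d predT (pull W) s x = pull (chart_d predT W) s x.
Proof.
move=> + + Ux; elim: s W => [|a s IH] W aW sW; first by rewrite /= !chart_d_nil.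
have sW' b : smooth_form U' (contract b W) by move=> t; exact: sW.
have dp b t : cdiff (pull (contract b W) t) x by exact: cdiff_pull.
rewrite chart_d_cons mul1r (wirtinger_pull a s aW sW Ux).
have -> : contract a (pull W) =
    fun t y => \sum_b jac a b y * pull (contract b W) t y by [].
rewrite chart_d_sum; last by move=> b t; apply: cdiffM => //; exact: cdiff_jac.
under [X in _ - X]eq_bigr => b _ do
  rewrite (chart_d_mul _ (cdiff_jac a b Ux) (dp b))
    (IH _ (contract_alternating _ aW) (sW' b)).
rewrite big_split /= opprD addrACA subrr add0r.
rewrite -sumrB; apply: eq_bigr => b _; rewrite contract_chart_d pull_lin.
by rewrite mul1r mulN1r mulrBr.
Qed.

End Pullback.

(** The predicate reads the whole pattern of types rather than two counts: contracting with a then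
    just replaces q by its restriction to patterns starting with the type of a, which suits
    induction. *)
Definition proj (q : pred (seq bool)) W : cforms := fun s x =>
  if q (map (fun a => is_inl a) s) then W s x else 0.

(** A Jacobian without mixed entries transforms each pattern of types separately; this is where
    holomorphy makes bidegree independent of the chart. *)
Lemma pull_proj phi q W s x :
  (forall a b, is_inl a != is_inl b -> jac phi a b x = 0) ->
  pull phi (proj q W) s x = proj q (pull phi W) s x.
Proof.
move=> J0; elim: s q W => [//|a s IH] q W.
rewrite /proj /=.
transitivity (\sum_b jac phi a b x *
    proj (fun r => q (is_inl a :: r)) (pull phi (contract b W)) s x).
  apply: eq_bigr => b _; have [E|/J0 ->] := eqVneq (is_inl a) (is_inl b).
    rewrite -IH; congr (_ * pull phi _ s x).
    by apply/funext => t; apply/funext => y; rewrite /contract /proj /= E.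
  by rewrite !mul0r.
rewrite /proj; case: ifP => // _; rewrite big1 // => b _.
by rewrite mulr0.
Qed.

Definition conjf W : cforms := fun s x => ((W (map (@cswap n) s) x)^*)%C.

Lemma pull_conj phi W s x :
  (forall a b, jac phi (cswap a) (cswap b) x = ((jac phi a b x)^*)%C) ->
  pull phi (conjf W) s x = conjf (pull phi W) s x.
Proof.
move=> Jc; elim: s W => [//|a s IH] W; rewrite /conjf /= rmorph_sum.
rewrite [RHS](reindex_inj (can_inj (@cswapK n))); apply: eq_bigr => b _ /=.
rewrite rmorphM /= Jc conjcK; apply: (congr1 (fun z => jac phi a b x * z)).
exact: (IH (contract (cswap b) W)).
Qed.

Lemma chart_d_conj P W s x : (forall t, cdiff (W t) x) ->
  chart_d P (conjf W) s x = conjf (chart_d (fun a => P (cswap a)) W) s x.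
Proof.
elim: s W => [|a s IH] W dW.
  by rewrite /conjf /= !chart_d_nil rmorph0.
rewrite [in RHS]/conjf /= !chart_d_cons cswapK rmorphB rmorphM.
rewrite rmorph_nat /= -(wirtinger_conj a (dW (map (@cswap n) s))).
apply: (congr1 (fun z => (P a)%:R * wirtinger a (conjf W s) x - z)).
by apply: (IH (contract (cswap a) W)) => t; exact: dW.
Qed.

End ChartForms.

(** * Forms on a manifold *)

Section ManifoldForms.
Variables (R : realType) (n : nat) (M : complex_manifold R n).
Local Notation V := (cspace R n).
Local Notation L := (clabel n).
Local Notation d := (@ext_d R n M).
Implicit Types (w u v : components M) (i j : chart M) (s t : seq L) (x : V).
Implicit Types (P Q : pred L) (a b : L).

Local Opaque wirtinger.

Definition overlap i j : set V := cod i `&` param i @^-1` dom j.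

Definition transition i j : V -> V := fun x => Defs.coord j (param i x).

Lemma overlap_open i j : open (overlap i j).
Proof.
have := @param_continuous _ _ M i.
rewrite (continuous_open_subspace _ (@cod_open _ _ M i)) => pc.
rewrite openE => x [xi xj]; rewrite /interior; apply: filterI.
  exact: (open_nbhs_nbhs (conj (@cod_open _ _ M i) xi)).
apply: (pc x (mem_set xi)); apply: open_nbhs_nbhs; split=> //.
exact: dom_open.
Qed.

Lemma transition_cod i j x : overlap i j x -> cod j (transition i j x).
Proof. by move=> [_ xj]; exact: coord_cod. Qed.

Lemma transition_ccoord_inr i j k :
  (fun x => ccoord (inr k) (transition i j x)) =
  fun x => ((ccoord (inl k) (transition i j x))^*)%C.
Proof. by apply/funext => x; rewrite -ccoord_conj. Qed.

Lemma transition_smooth i j b :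
  smooth_on (overlap i j) (fun x => ccoord b (transition i j x)).
Proof.
case: b => k; first by case: (@transition_holomorphic _ _ M i j k).
rewrite transition_ccoord_inr; apply: smooth_on_conj; first exact: overlap_open.
by case: (@transition_holomorphic _ _ M i j k).
Qed.

(** The [inr] coordinates of the transition map are the conjugates of its [inl] coordinates, so
    conjugating an entry swaps both labels. *)
Lemma jac_conj i j a b x : overlap i j x ->
  jac (transition i j) (cswap a) (cswap b) x = ((jac (transition i j) a b x)^*)%C.
Proof.
move=> xU.
have dk k : cdiff (fun x => ccoord (inl k) (transition i j x)) x.
  by apply: smooth_on_cdiff xU; exact: transition_smooth.
case: b => k; rewrite /jac.
  rewrite (transition_ccoord_inr i j k).
  by rewrite (wirtinger_conj _ (dk k)) cswapK.
rewrite (transition_ccoord_inr i j k) (wirtinger_conj _ (dk k)).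
by rewrite conjcK.
Qed.

Lemma jac_mixed i j a b x : overlap i j x -> is_inl a != is_inl b ->
  jac (transition i j) a b x = 0.
Proof.
move=> xU; case: a => l; case: b => k //= _; last first.
  by case: (@transition_holomorphic _ _ M i j k) => _; exact.
(* The remaining mixed block is the conjugate of the one killed by the Cauchy-Riemann equations. *)
rewrite -[jac _ _ _ _]conjcK -jac_conj //.
case: (@transition_holomorphic _ _ M i j k) => _ H.
by rewrite [jac _ _ _ _](H l x xU) rmorph0.
Qed.

Lemma form_pull w i j s x : is_form w -> overlap i j x ->
  w i s x = pull (transition i j) (w j) s x.
Proof. by move=> fw [xi xj]; rewrite pullE; exact: form_change_of_chart. Qed.

Lemma form_cdiff w i s x : is_form w -> cod i x -> cdiff (w i s) x.
Proof. by move=> fw xi; exact: smooth_on_cdiff (form_smooth fw i s) xi. Qed.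

(** Off the image of the chart all components are 0, so alternation need only be checked on it; the
    change of charts becomes a pullback. *)
Lemma is_formP w : (forall i s x, ~ cod i x -> w i s x = 0) ->
  (forall i s, smooth_on (cod i) (w i s)) ->
  (forall i s1 a b s2 x, cod i x ->
     w i (s1 ++ [:: a, b & s2]) x = - w i (s1 ++ [:: b, a & s2]) x) ->
  (forall i j s x, overlap i j x -> w i s x = pull (transition i j) (w j) s x) ->
  is_form w.
Proof.
move=> w0 ws wa wc; split=> // [i s1 a b s2 x|i j s x xi xj].
  have [/wa->//|xi] := pselect (cod i x).
  by rewrite !w0 // oppr0.
by rewrite (wc i j) // pullE.
Qed.

Lemma is_form_lin (k l : R[i]) w1 w2 : is_form w1 -> is_form w2 ->
  is_form (k *: w1 + l *: w2).
Proof.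
move=> f1 f2; have E i s x : (k *: w1 + l *: w2) i s x = k * w1 i s x + l * w2 i s x.
  by [].
apply: is_formP => [i s x xi|i s|i s1 a b s2 x xi|i j s x xU].
- by rewrite E !form_outside // !mulr0 addr0.
- have oi := @cod_open _ _ M i.
  apply: (smooth_onD oi (f := fun x => k * w1 i s x) (g := fun x => l * w2 i s x)).
    exact: (smooth_onZ oi k (form_smooth f1 i s)).
  exact: (smooth_onZ oi l (form_smooth f2 i s)).
- by rewrite !E (form_alternating f1) (form_alternating f2) !mulrN opprD.
- have -> : (k *: w1 + l *: w2) j = lincomb k l (w1 j) (w2 j) by [].
  by rewrite pull_lin E (form_pull s f1 xU) (form_pull s f2 xU).
Qed.

Lemma is_form0 : is_form (0 : components M).
Proof.
apply: is_formP => [//|i s|i s1 a b s2 x _|i j s x xU].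
- apply: (smooth_on_ext (@cod_open _ _ M i) (f := fun=> 0)) => //.
  exact: smooth_on_cst.
- by rewrite -[LHS]/(0 : R[i]) -[in RHS]/(0 : R[i]) oppr0.
- elim: s x xU => [//|a s IH] x xU /=; rewrite big1 // => b _.
  by rewrite -[contract b _]/((0 : components M) j) -IH // mulr0.
Qed.

Lemma is_formB w1 w2 : is_form w1 -> is_form w2 -> is_form (w1 - w2).
Proof.
by move=> f1 f2; have := is_form_lin 1 (-1) f1 f2; rewrite scale1r scaleN1r.
Qed.

Lemma partial_d_in P w i s x : cod i x -> partial_d P w i s x = chart_d P (w i) s x.
Proof. by move=> xi; rewrite /partial_d mem_set. Qed.

Lemma partial_d_out P w i s x : ~ cod i x -> partial_d P w i s x = 0.
Proof. by move=> xi; rewrite /partial_d memNset. Qed.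

Lemma components_ext w1 w2 : (forall i s x, ~ cod i x -> w1 i s x = w2 i s x) ->
  (forall i s x, cod i x -> w1 i s x = w2 i s x) -> w1 = w2.
Proof.
move=> E1 E2; apply/funext => i; apply/funext => s; apply/funext => x.
by have [xi|xi] := pselect (cod i x); [exact: E2|exact: E1].
Qed.

Lemma partial_d_lin P (k l : R[i]) w1 w2 : is_form w1 -> is_form w2 ->
  partial_d P (k *: w1 + l *: w2) = k *: partial_d P w1 + l *: partial_d P w2.
Proof.
move=> f1 f2.
have E (a b : components M) i s x :
    (k *: a + l *: b) i s x = k * a i s x + l * b i s x.
  by [].
apply: components_ext => i s x xi; rewrite E.
  by rewrite !partial_d_out // !mulr0 addr0.
rewrite !partial_d_in //.
have -> : (k *: w1 + l *: w2) i = lincomb k l (w1 i) (w2 i) by [].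
by rewrite chart_d_lin // => t; exact: form_cdiff.
Qed.

Lemma partial_d0 P : partial_d P 0 = 0 :> components M.
Proof.
by have := partial_d_lin P 0 0 is_form0 is_form0; rewrite !scale0r !addr0.
Qed.

Lemma partial_dD P w1 w2 : is_form w1 -> is_form w2 ->
  partial_d P (w1 + w2) = partial_d P w1 + partial_d P w2.
Proof.
by move=> f1 f2; rewrite -{1}(scale1r w1) -{1}(scale1r w2) partial_d_lin // !scale1r.
Qed.

Lemma partial_dB P w1 w2 : is_form w1 -> is_form w2 ->
  partial_d P (w1 - w2) = partial_d P w1 - partial_d P w2.
Proof.
by move=> f1 f2; have := partial_d_lin P 1 (-1) f1 f2; rewrite !scale1r !scaleN1r.
Qed.

Lemma partial_d_anticomm P Q w : is_form w ->
  partial_d P (partial_d Q w) + partial_d Q (partial_d P w) = 0.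
Proof.
move=> fw.
have E (a b : components M) i s x : (a + b) i s x = a i s x + b i s x by [].
apply: components_ext => i s x xi; rewrite E -[RHS]/(0 : R[i]).
  by rewrite !partial_d_out // addr0.
have sw : smooth_form (cod i) (w i) by exact: form_smooth.
(* [partial_d] agrees with [chart_d] only on the image of the chart; that set is open, so the
   agreement survives a further derivative. *)
have E1 P' Q' :
    chart_d P' (partial_d Q' w i) s x = chart_d P' (chart_d Q' (w i)) s x.
  apply: (chart_d_on P' s (@cod_open _ _ M i) xi) => t y yi.
  exact: partial_d_in.
rewrite !partial_d_in // !E1.
exact: (chart_d_anticomm (@cod_open _ _ M i) xi P Q s sw).
Qed.

Lemma partial_d_smooth P w i s : is_form w -> smooth_on (cod i) (partial_d P w i s).
Proof.
move=> fw; have oi := @cod_open _ _ M i.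
apply: (smooth_on_ext oi (f := chart_d P (w i) s)); last first.
  by apply: chart_d_smooth => // t; exact: form_smooth.
by move=> x xi; rewrite partial_d_in.
Qed.

(** Compatibility with changes of chart is d T = T d for the transition map. *)
Lemma is_form_d w : is_form w -> is_form (d w).
Proof.
move=> fw; apply: is_formP => [i s x|i s|i s1 a b s2 x xi|i j s x xU].
- exact: partial_d_out.
- exact: partial_d_smooth.
- rewrite /ext_d !partial_d_in //.
  apply: (chart_d_alternating _ _ _ _ _ _ _ xi) => [s1' a' b' s2' y|t].
    exact: form_alternating.
  exact: form_smooth.
- have xi := xU.1; have sj : smooth_form (cod j) (w j) by exact: form_smooth.
  rewrite /ext_d partial_d_in //.
  (* The overlap is open, so the components in chart i may be replaced by the pulled back ones
     before differentiating. *)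
  rewrite (chart_d_on predT s (@overlap_open i j) xU
    (fun t y yU => form_pull t fw yU)).
  have aj : alternating (w j) by exact: form_alternating.
  rewrite (chart_d_pull (@overlap_open i j) (@transition_cod i j)
    (@transition_smooth i j) s aj sj xU).
  apply: pull_ext => t; rewrite partial_d_in //; exact: transition_cod.
Qed.

End ManifoldForms.

(** * Bidegree and conjugation *)

Section Bidegree.
Variables (R : realType) (n : nat) (M : complex_manifold R n).
Local Notation V := (cspace R n).
Local Notation L := (clabel n).
Local Notation d := (@ext_d R n M).
Implicit Types (w u v : components M) (i j : chart M) (s t : seq L) (x : V).
Implicit Types (P Q : pred L) (a b : L) (p q : nat) (S : nat -> nat -> bool).

Local Opaque wirtinger.

Definition holo s := count (fun a => is_inl a) s.
Definition anti s := count (fun a => ~~ is_inl a) s.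

Definition projf p q w : components M :=
  fun i => proj (fun r => (count id r == p) && (count negb r == q)) (w i).

Definition cjf w : components M := fun i => conjf (w i).

(** Natural bidegrees and a boolean S turn inclusions between sets of bidegrees into arithmetic. *)
Definition supp S w : Prop :=
  forall i s x, ~~ S (holo s) (anti s) -> w i s x = 0.

Lemma projfE p q w i s x : projf p q w i s x =
  if (holo s == p) && (anti s == q) then w i s x else 0.
Proof. by rewrite /projf /proj !count_map. Qed.

Lemma count_remove (P : pred L) s (l : 'I_(size s)) :
  count P s = (P (tnth (in_tuple s) l) + count P (take l s ++ drop l.+1 s))%N.
Proof.
set a := tnth (in_tuple s) l; have aE : nth a s l = a by rewrite {2}/a (tnth_nth a).
by rewrite -[in LHS](cat_take_drop l s) (drop_nth a) // !count_cat /= aE addnCA.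
Qed.

Lemma is_form_projf p q w : is_form w -> is_form (projf p q w).
Proof.
move=> fw; apply: is_formP => [i s x xi|i s|i s1 a b s2 x xi|i j s x xU].
- by rewrite projfE form_outside // if_same.
- have oi := @cod_open _ _ M i.
  have [E|/negPf E] := boolP ((holo s == p) && (anti s == q)).
    apply: (smooth_on_ext oi _ (form_smooth fw i s)) => x _.
    by rewrite projfE E.
  apply: (smooth_on_ext oi (f := fun=> 0)) => [x _|]; first by rewrite projfE E.
  exact: smooth_on_cst.
- rewrite !projfE (form_alternating fw).
  rewrite /holo /anti !count_cat /= !(addnCA (is_inl a)) !(addnCA (~~ is_inl a)).
  by case: ifP; rewrite ?oppr0.
- rewrite pull_proj; last by move=> a b; exact: jac_mixed.
  by rewrite /projf /proj (form_pull s fw xU).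
Qed.

Lemma is_form_cjf w : is_form w -> is_form (cjf w).
Proof.
move=> fw; apply: is_formP => [i s x xi|i s|i s1 a b s2 x xi|i j s x xU].
- by rewrite /cjf /conjf form_outside // rmorph0.
- by apply: smooth_on_conj; [exact: cod_open|exact: form_smooth].
- by rewrite /cjf /conjf !map_cat /= (form_alternating fw) rmorphN.
- rewrite pull_conj; last by move=> a b; exact: jac_conj.
  by rewrite /cjf /conjf (form_pull _ fw xU).
Qed.

Lemma cjfK : involutive cjf.
Proof.
move=> w; apply/funext => i; apply/funext => s; apply/funext => x.
by rewrite /cjf /conjf conjcK -map_comp (eq_map (@cswapK n)) map_id.
Qed.

Lemma partial_d_cjf P w : is_form w ->
  partial_d P (cjf w) = cjf (partial_d (fun a => P (cswap a)) w).
Proof.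
move=> fw; apply: components_ext => i s x xi.
  by rewrite /cjf /conjf !partial_d_out // rmorph0.
rewrite partial_d_in // [RHS]/cjf /conjf partial_d_in //.
by rewrite chart_d_conj // => t; exact: form_cdiff.
Qed.

Lemma ext_d_cjf w : is_form w -> d (cjf w) = cjf (d w).
Proof. by move=> fw; rewrite /ext_d partial_d_cjf. Qed.

Lemma ext_d0 : d 0 = 0. Proof. exact: partial_d0. Qed.

Lemma ext_d_lin (k l : R[i]) w1 w2 : is_form w1 -> is_form w2 ->
  d (k *: w1 + l *: w2) = k *: d w1 + l *: d w2.
Proof. exact: partial_d_lin. Qed.

Lemma ext_dD w1 w2 : is_form w1 -> is_form w2 -> d (w1 + w2) = d w1 + d w2.
Proof. exact: partial_dD. Qed.

Lemma ext_dB w1 w2 : is_form w1 -> is_form w2 -> d (w1 - w2) = d w1 - d w2.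
Proof. exact: partial_dB. Qed.

Lemma cjfD w1 w2 : cjf (w1 + w2) = cjf w1 + cjf w2.
Proof.
apply/funext => i; apply/funext => s; apply/funext => x.
exact: (rmorphD (@conjc R)).
Qed.

Lemma cjf0 : cjf 0 = 0.
Proof.
apply/funext => i; apply/funext => s; apply/funext => x.
exact: (rmorph0 (@conjc R)).
Qed.

Lemma cjfZ (k : R[i]) w : cjf (k *: w) = (k^*)%C *: cjf w.
Proof.
apply/funext => i; apply/funext => s; apply/funext => x.
exact: (rmorphM (@conjc R)).
Qed.

Lemma ext_d_del_delbar w : d w = del w + delbar w.
Proof.
apply/funext => i; apply/funext => s; apply/funext => x.
rewrite -[RHS]/(del w i s x + delbar w i s x).
rewrite /ext_d /del /delbar /partial_d; case: ifP => _; last by rewrite addr0.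
rewrite (bigID (fun l : 'I_(size s) => is_inl (tnth (in_tuple s) l))) /=.
by [].
Qed.

Lemma del_delbar w : is_form w -> del (delbar w) = - delbar (del w).
Proof.
move=> fw; apply/eqP; rewrite -addr_eq0; apply/eqP.
exact: partial_d_anticomm.
Qed.

(** Anticommutation with P = Q says that twice the square is 0. *)
Let anticomm_diag P w : is_form w -> partial_d P (partial_d P w) = 0.
Proof.
move=> fw; have E := partial_d_anticomm P P fw.
apply/funext => i; apply/funext => s; apply/funext => x.
have : partial_d P (partial_d P w) i s x + partial_d P (partial_d P w) i s x = 0.
  exact: (congr1 (fun f => f i s x) E).
by rewrite -mulr2n => /eqP; rewrite mulrn_eq0 /= => /eqP ->.
Qed.

Lemma ext_d_ext_d w : is_form w -> d (d w) = 0.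
Proof. exact: anticomm_diag. Qed.

Lemma del_del w : is_form w -> del (del w) = 0.
Proof. exact: anticomm_diag. Qed.

Lemma delbar_delbar w : is_form w -> delbar (delbar w) = 0.
Proof. exact: anticomm_diag. Qed.

(** The hypothesis says that deleting a label in P leads to bidegree (p, q) exactly from bidegree
    (p', q'). *)
Lemma partial_d_projf P p q p' q' w :
  (forall s (l : 'I_(size s)), P (tnth (in_tuple s) l) ->
     (holo (take l s ++ drop l.+1 s) == p) && (anti (take l s ++ drop l.+1 s) == q)
     = (holo s == p') && (anti s == q')) ->
  partial_d P (projf p q w) = projf p' q' (partial_d P w).
Proof.
move=> E; apply/funext => i; apply/funext => s; apply/funext => x.
rewrite projfE /partial_d; case: ifP => _; last by rewrite if_same.
transitivity (\sum_(l < size s | P (tnth (in_tuple s) l))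
   if (holo s == p') && (anti s == q') then (-1) ^+ l *
        wirtinger (tnth (in_tuple s) l) (w i (take l s ++ drop l.+1 s)) x else 0).
  apply: eq_bigr => l Pl; rewrite -(E s l Pl).
  rewrite /projf /proj !count_map; case: ifP => // _.
  by rewrite wirtinger_cst mulr0.
by case: ifP => // _; rewrite big1.
Qed.

Lemma del_projf p q w : del (projf p q w) = projf p.+1 q (del w).
Proof.
apply: partial_d_projf => s l Pl.
rewrite /holo /anti (count_remove (fun a => is_inl a) l) Pl.
by rewrite (count_remove (fun a => ~~ is_inl a) l) Pl add1n eqSS add0n.
Qed.

Lemma delbar_projf p q w : delbar (projf p q w) = projf p q.+1 (delbar w).
Proof.
apply: partial_d_projf => s l Pl.
rewrite /holo /anti (count_remove (fun a => is_inl a) l) (negPf Pl).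
by rewrite (count_remove (fun a => ~~ is_inl a) l) Pl add1n eqSS add0n.
Qed.

Lemma supp_sub S S' w : (forall p q, S p q -> S' p q) -> supp S w -> supp S' w.
Proof.
move=> SS' sw i s x nS'; apply: sw; apply: contra nS'; exact: SS'.
Qed.

Lemma supp_and S S' w : supp S w -> supp S' w -> supp (fun p q => S p q && S' p q) w.
Proof. by move=> sw sw' i s x; rewrite negb_and => /orP[/sw|/sw']. Qed.

Lemma supp_lin S (k l : R[i]) w1 w2 : supp S w1 -> supp S w2 ->
  supp S (k *: w1 + l *: w2).
Proof.
move=> s1 s2 i s x nS; rewrite -[LHS]/(k * w1 i s x + l * w2 i s x).
by rewrite s1 // s2 // !mulr0 addr0.
Qed.

Lemma supp0 S : supp S (0 : components M). Proof. by []. Qed.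

Lemma suppD S w1 w2 : supp S w1 -> supp S w2 -> supp S (w1 + w2).
Proof.
move=> s1 s2 i s x nS.
by rewrite -[LHS]/(w1 i s x + w2 i s x) s1 // s2 // addr0.
Qed.

Lemma supp_projf S p q w : supp S w ->
  supp (fun p' q' => [&& S p' q', p' == p & q' == q]) (projf p q w).
Proof.
by move=> sw i s x; rewrite projfE negb_and; case: ifP => // _ /orP[/sw|].
Qed.

Lemma supp_cjf S w : supp S w -> supp (fun p q => S q p) (cjf w).
Proof.
move=> sw i s x nS; rewrite /cjf /conjf sw ?rmorph0 //; move: nS.
rewrite /holo /anti !count_map.
by congr (~~ S _ _); apply: eq_count => -[].
Qed.

Lemma supp_del S w : supp S w ->
  supp (fun p q => (0 < p)%N && S p.-1 q) (del w).
Proof.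
move=> sw i s x nS; rewrite /del /partial_d; case: ifP => // _.
apply: big1 => l Pl; move: nS.
rewrite /holo /anti (count_remove (fun a => is_inl a) l) Pl.
rewrite (count_remove (fun a => ~~ is_inl a) l) Pl add1n add0n /= => nS.
have -> : w i (take l s ++ drop l.+1 s) = fun=> 0 by apply/funext => y; exact: sw.
by rewrite wirtinger_cst mulr0.
Qed.

Lemma supp_delbar S w : supp S w ->
  supp (fun p q => (0 < q)%N && S p q.-1) (delbar w).
Proof.
move=> sw i s x nS; rewrite /delbar /partial_d; case: ifP => // _.
apply: big1 => l Pl; move: nS.
rewrite /holo /anti (count_remove (fun a => is_inl a) l) (negPf Pl).
rewrite (count_remove (fun a => ~~ is_inl a) l) Pl add1n add0n /= => nS.
have -> : w i (take l s ++ drop l.+1 s) = fun=> 0 by apply/funext => y; exact: sw.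
by rewrite wirtinger_cst mulr0.
Qed.

Lemma supp_d S w : supp S w ->
  supp (fun p q => ((0 < p)%N && S p.-1 q) || ((0 < q)%N && S p q.-1)) (d w).
Proof.
move=> sw; rewrite ext_d_del_delbar; apply: suppD.
  by apply: supp_sub (supp_del sw) => p q ->.
by apply: supp_sub (supp_delbar sw) => p q ->; rewrite orbT.
Qed.

Lemma projf_id p q w : supp (fun p' q' => (p' == p) && (q' == q)) w ->
  projf p q w = w.
Proof.
move=> sw; apply/funext => i; apply/funext => s; apply/funext => x.
by rewrite projfE; case: ifP => // /negbT/sw ->.
Qed.

Lemma projf0 S p q w : supp S w -> ~~ S p q -> projf p q w = 0.
Proof.
move=> sw nS; apply/funext => i; apply/funext => s; apply/funext => x.
by rewrite projfE; case: ifP => // /andP[/eqP hp /eqP aq]; apply: sw; rewrite hp aq.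
Qed.

Lemma projfD p q w1 w2 : projf p q (w1 + w2) = projf p q w1 + projf p q w2.
Proof.
apply/funext => i; apply/funext => s; apply/funext => x.
rewrite -[RHS]/(projf p q w1 i s x + projf p q w2 i s x) !projfE.
by case: ifP => // _; rewrite addr0.
Qed.

Section Pure.
Variables (p q : nat) (w : components M).
Hypotheses (fw : is_form w) (sw : supp (fun p' q' => (p' == p) && (q' == q)) w).

(** The other part, delbar w, has type (p, q + 1). Being a component of d w, [del w] inherits its
    independence of the chart from d and from the projection. *)
Lemma del_pure : del w = projf p.+1 q (d w).
Proof.
rewrite ext_d_del_delbar projfD (projf0 (supp_delbar sw)).
  by rewrite addr0 -del_projf projf_id.
by rewrite negb_and [_.+1 == _]gtn_eqF ?orbT.
Qed.

Lemma delbar_pure : delbar w = projf p q.+1 (d w).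
Proof.
rewrite ext_d_del_delbar projfD (projf0 (supp_del sw)).
  by rewrite add0r -delbar_projf projf_id.
by rewrite !negb_and [_.+1 == _]gtn_eqF ?orbT.
Qed.

Lemma is_form_del : is_form (del w).
Proof. by rewrite del_pure; apply: is_form_projf; exact: is_form_d. Qed.

Lemma is_form_delbar : is_form (delbar w).
Proof. by rewrite delbar_pure; apply: is_form_projf; exact: is_form_d. Qed.

End Pure.

End Bidegree.

(** * Dimensions of quotients *)

Definition subspace_of (K : pzRingType) (E : lmodType K) (S : set E) : Prop :=
  S 0 /\ forall k x y, S x -> S y -> S (k *: x + y).

Section Subspace.
Variables (K : pzRingType) (E : lmodType K) (S : set E).
Hypothesis hS : subspace_of S.

Lemma subspaceD x y : S x -> S y -> S (x + y).
Proof. by move=> Sx Sy; rewrite -(scale1r x); apply: hS.2. Qed.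

Lemma subspaceB x y : S x -> S y -> S (x - y).
Proof. by move=> Sx Sy; rewrite -scaleN1r addrC; apply: hS.2. Qed.

Lemma subspace_sum I (r : seq I) (c : I -> K) (v : I -> E) :
  (forall i, S (v i)) -> S (\sum_(i <- r) c i *: v i).
Proof.
move=> Sv; elim: r => [|i r IH]; first by rewrite big_nil; exact: hS.1.
by rewrite big_cons; apply: hS.2.
Qed.

End Subspace.

(** Take A of maximal rank among the matrices whose row space lies in S; a vector of S outside it
    would raise the rank. *)
Lemma subspace_mx (K : fieldType) m (S : set 'rV[K]_m) : subspace_of S ->
  exists A : 'M[K]_m, forall u, S u <-> (u <= A)%MS.
Proof.
move=> hS.
pose P r := `[< exists2 A : 'M[K]_m, \rank A = r &
  forall u : 'rV_m, (u <= A)%MS -> S u >].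
have exP : exists r, P r.
  exists 0%N; apply/asboolP; exists 0; first exact: mxrank0.
  by move=> u; rewrite submx0 => /eqP ->; exact: hS.1.
have leP r : P r -> (r <= m)%N by move=> /asboolP[A <- _]; exact: rank_leq_row.
case: (ex_maxnP exP leP) => r /asboolP[A rA AS] maxr.
exists A => u; split=> [Su|]; last exact: AS.
apply/negPn/negP => nuA.
have : P (\rank (A + u)%MS).
  apply/asboolP; exists (A + u)%MS => // v /sub_addsmxP[[v1 v2] /= ->].
  rewrite addrC [v2]mx11_scalar mul_scalar_mx; apply: hS.2 => //.
  by apply: AS; exact: submxMl.
move=> /maxr; rewrite -rA leqNgt => /negP; apply.
apply: rank_ltmx; rewrite ltmxE addsmxSl; apply: contra nuA.
by apply: submx_trans; exact: addsmxSr.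
Qed.

Section DimQuotient.
Variable R : realType.
Local Notation K := R[i].
Variable E : lmodType K.
Implicit Types (Z B C X P : set E).

Lemma dim_quotient_ge Z B m (v : 'I_m -> E) : (forall k, Z (v k)) ->
  (forall c : 'I_m -> K, B (\sum_k c k *: v k) -> forall k, c k = 0) ->
  (m%:R%:E <= dim_quotient Z B)%E.
Proof. by move=> Zv iv; apply: ereal_sup_ubound; exists m => //; exists v. Qed.

Lemma dim_quotient_le Z B (y : \bar R) :
  (forall m (v : 'I_m -> E), (forall k, Z (v k)) ->
    (forall c : 'I_m -> K, B (\sum_k c k *: v k) -> forall k, c k = 0) ->
    (m%:R%:E <= y)%E) ->
  (dim_quotient Z B <= y)%E.
Proof. by move=> H; apply: ge_ereal_sup => _ [m [v Zv iv] <-]; exact: (H m v). Qed.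

Lemma dim_quotient_ge0 Z B : (0 <= dim_quotient Z B)%E.
Proof.
apply: (@dim_quotient_ge Z B 0%N (fun=> 0)) => [[]//|c _ []//].
Qed.

(** The empty family gives y <= c. Hence y is finite unless c = +oo, where nothing is to be shown,
    and it can be moved across before bounding the supremum. *)
Lemma dim_quotientD_le Z B (y c : \bar R) : (0 <= y)%E ->
  (forall m (v : 'I_m -> E), (forall k, Z (v k)) ->
    (forall c : 'I_m -> K, B (\sum_k c k *: v k) -> forall k, c k = 0) ->
    (m%:R%:E + y <= c)%E) ->
  (dim_quotient Z B + y <= c)%E.
Proof.
move=> y0 H.
have yc : (y <= c)%E.
  have := H 0%N (fun=> 0); rewrite add0e; apply; [by case|by move=> ? _ []].
case: c yc H => [c| |] yc H; last 2 first.
- exact: leey.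
- by have := le_trans y0 yc.
have yfin : y \is a fin_num.
  by rewrite ge0_fin_numE // (le_lt_trans yc) ?ltry.
rewrite -leeBrDr //; apply: dim_quotient_le => m v Zv iv.
by rewrite leeBrDr //; exact: H iv.
Qed.

(** An antilinear f conjugates the coefficients of a linear relation, so independence carries over
    to the image family. For an involution, a second application reverses the inequality. *)
Lemma dim_quotient_conj (f : E -> E) Z B :
  (forall k l x y, f (k *: x + l *: y) = (k^*)%C *: f x + (l^*)%C *: f y) ->
  (dim_quotient (f @^-1` Z) (f @^-1` B) <= dim_quotient Z B)%E.
Proof.
move=> fl; apply: dim_quotient_le => m v Zv iv.
have f0 : f 0 = 0.
  by have := fl 0 0 0 0; rewrite !scale0r addr0 rmorph0 !scale0r addr0.
have fs (c : 'I_m -> K) : f (\sum_k c k *: v k) = \sum_k ((c k)^*)%C *: f (v k).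
  elim/big_rec2: _ => [//|k a b _ <-].
  by have := fl (c k) 1 (v k) b; rewrite rmorph1 !scale1r.
apply: (@dim_quotient_ge Z B m (f \o v)) => // c Bc k.
have /(_ k) : forall k, ((c k)^*)%C = 0.
  apply: iv; rewrite /preimage /= fs.
  by under eq_bigr do rewrite conjcK.
by move=> /(congr1 (fun z => (z^*)%C)); rewrite conjcK rmorph0.
Qed.

Definition comb m (v : 'I_m -> E) (u : 'rV[K]_m) : E := \sum_j u ord0 j *: v j.

Lemma comb_lin m (v : 'I_m -> E) k u1 u2 :
  comb v (k *: u1 + u2) = k *: comb v u1 + comb v u2.
Proof.
rewrite /comb scaler_sumr -big_split; apply: eq_bigr => j _.
by rewrite !mxE scalerDl scalerA.
Qed.

Lemma comb_mulmx m p (v : 'I_m -> E) (A : 'M[K]_(p, m)) (c : 'I_p -> K) :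
  \sum_i c i *: comb v (row i A) = comb v ((\row_i c i) *m A).
Proof.
rewrite /comb; under eq_bigr do rewrite scaler_sumr.
rewrite exchange_big; apply: eq_bigr => j _ /=.
rewrite mxE scaler_suml; apply: eq_bigr => i _.
by rewrite !mxE scalerA.
Qed.

(** The kernel of C^m -> E / B is presented as a row space, without forming the quotient. *)
Lemma comb_kernel m (v : 'I_m -> E) B : subspace_of B ->
  exists A : 'M[K]_m, forall u, B (comb v u) <-> (u <= A)%MS.
Proof.
move=> hB; apply: (subspace_mx (S := [set u | B (comb v u)])); split.
  rewrite /= (_ : comb v 0 = 0); first exact: hB.1.
  by rewrite /comb big1 // => j _; rewrite mxE scale0r.
by move=> k x y /= Bx By; rewrite comb_lin; exact: hB.2.
Qed.

Lemma comb_in m (v : 'I_m -> E) Z u : subspace_of Z -> (forall k, Z (v k)) ->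
  Z (comb v u).
Proof. by move=> hZ Zv; exact: subspace_sum. Qed.

Lemma row_free_coef0 m p (A : 'M[K]_(p, m)) (c : 'I_p -> K) : row_free A ->
  (\row_i c i) *m A = 0 -> forall k, c k = 0.
Proof.
move=> fA cA0 k; have : \row_i c i = 0.
  by apply: (row_free_inj fA); rewrite cA0 mul0mx.
by move=> /rowP/(_ k); rewrite !mxE.
Qed.

(** A complement of the kernel of C^m -> Z / B embeds in Z / B. *)
Lemma corank_le_dim_quotient m (v : 'I_m -> E) Z B (A : 'M[K]_m) :
  subspace_of Z -> (forall k, Z (v k)) ->
  (forall u, B (comb v u) <-> (u <= A)%MS) ->
  ((m - \rank A)%:R%:E <= dim_quotient Z B)%E.
Proof.
move=> hZ Zv BA; rewrite -mxrank_compl; pose C := row_base A^C%MS.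
apply: (@dim_quotient_ge Z B _ (fun i => comb v (row i C))) => [i|c].
  exact: comb_in.
rewrite comb_mulmx => /BA cA; apply: (row_free_coef0 (row_base_free _)).
have : ((\row_i c i) *m C <= A :&: A^C)%MS.
  rewrite sub_capmx cA (submx_trans (submxMl _ _)) //.
  by rewrite /C eq_row_base.
by rewrite capmx_compl submx0 => /eqP.
Qed.

(* In C^m, the kernels of the maps to Z1/B1 and Z2/B2 have corank at most their
   dimensions, and the intersection of the kernels embeds in Z3/B3. *)
Lemma dim_quotient_le_sum C X Z1 B1 Z2 B2 Z3 B3 :
  subspace_of C -> subspace_of X -> subspace_of B1 -> subspace_of B2 ->
  subspace_of Z1 -> subspace_of Z2 ->
  C `<=` Z1 -> C `<=` Z2 -> B3 `<=` X ->
  (forall w, C w -> B1 w -> B2 w -> exists2 z, Z3 z & X (w - z)) ->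
  (dim_quotient C X <=
   dim_quotient Z3 B3 + (dim_quotient Z1 B1 + dim_quotient Z2 B2))%E.
Proof.
move=> hC hX hB1 hB2 hZ1 hZ2 CZ1 CZ2 B3X H; apply: dim_quotient_le => m v Cv iv.
have [A1 A1P] := comb_kernel v hB1; have [A2 A2P] := comb_kernel v hB2.
have e1 := corank_le_dim_quotient hZ1 (fun k => CZ1 _ (Cv k)) A1P.
have e2 := corank_le_dim_quotient hZ2 (fun k => CZ2 _ (Cv k)) A2P.
pose D := row_base (A1 :&: A2)%MS.
have DB i : (row i D <= A1)%MS /\ (row i D <= A2)%MS.
  apply/andP; rewrite -sub_capmx (submx_trans (row_sub _ _)) //.
  by rewrite /D eq_row_base.
have Hz i : exists z, Z3 z /\ X (comb v (row i D) - z).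
  have [D1 D2] := DB i.
  have [||z Z3z Xz] := H (comb v (row i D)) (comb_in _ hC Cv).
  - exact/A1P.
  - exact/A2P.
  - by exists z.
have [z zP] := choice Hz.
(* A relation modulo [B3] among the z_i is a relation modulo X among the rows of D combined with v,
   and v is independent modulo X. *)
have e3 : ((\rank (A1 :&: A2)%MS)%:R%:E <= dim_quotient Z3 B3)%E.
  apply: (@dim_quotient_ge Z3 B3 _ z) => [i|c /B3X Xc]; first by case: (zP i).
  apply: (row_free_coef0 (row_base_free _)).
  have : X (comb v ((\row_i c i) *m D)).
    rewrite -comb_mulmx.
    have -> : \sum_i c i *: comb v (row i D) =
        \sum_i c i *: (comb v (row i D) - z i) + \sum_i c i *: z i.
      by rewrite -big_split; apply: eq_bigr => i _ /=; rewrite -scalerDr subrK.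
    apply: subspaceD => //; apply: subspace_sum => // i; by case: (zP i).
  move=> /iv H0; apply/rowP => j; rewrite H0 mxE.
  by [].
(* The count is m <= rank (A1 :&: A2) + (m - rank A1) + (m - rank A2), as rank (A1 + A2) <= m. *)
apply: le_trans (leeD e3 (leeD e1 e2)).
rewrite -!EFinD lee_fin -!natrD ler_nat.
have := mxrank_sum_cap A1 A2; have := rank_leq_row (A1 + A2)%MS.
have := rank_leq_row A1; have := rank_leq_row A2.
rewrite /=; lia.
Qed.

(** Independent families for the first two quotients are moved to representatives in [P1] and [P2]
    and joined to one in [Z3]. In a relation modulo X the first two parts fall into [B1] and [B2],
    so their coefficients vanish; the third part is then in X and [Z3], hence in [B3]. *)
Lemma dim_quotient_sum_le C X Z1 B1 Z2 B2 Z3 B3 P1 P2 :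
  subspace_of B1 -> subspace_of B2 -> subspace_of P1 -> subspace_of P2 ->
  subspace_of Z3 ->
  P1 `<=` C -> P2 `<=` C -> Z3 `<=` C ->
  (forall z, Z1 z -> exists2 w, P1 w & B1 (z - w)) ->
  (forall z, Z2 z -> exists2 w, P2 w & B2 (z - w)) ->
  (forall p1 p2 p3, P1 p1 -> P2 p2 -> Z3 p3 -> X (p1 + p2 + p3) ->
    B1 p1 /\ B2 p2) ->
  X `&` Z3 `<=` B3 ->
  (dim_quotient Z3 B3 + (dim_quotient Z1 B1 + dim_quotient Z2 B2) <=
   dim_quotient C X)%E.
Proof.
move=> hB1 hB2 hP1 hP2 hZ3 P1C P2C Z3C HZ1 HZ2 HX XB3.
have ge0 := dim_quotient_ge0.
apply: dim_quotientD_le => [|k v3 Zv3 iv3]; first by rewrite adde_ge0.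
rewrite addeCA; apply: dim_quotientD_le => [|m1 v1 Zv1 iv1].
  by rewrite adde_ge0 // lee_fin.
rewrite addeA [leLHS]addeC; apply: dim_quotientD_le => [|m2 v2 Zv2 iv2].
  by rewrite adde_ge0 // lee_fin.
have lift_family m (v : 'I_m -> E) Z B P : (forall i, Z (v i)) -> subspace_of B ->
    (forall z, Z z -> exists2 w, P w & B (z - w)) ->
    (forall c : 'I_m -> K, B (\sum_k c k *: v k) -> forall k, c k = 0) ->
    exists2 w : 'I_m -> E, forall i, P (w i) &
      forall c : 'I_m -> K, B (\sum_k c k *: w k) -> forall k, c k = 0.
  move=> Zv hB HZ iv.
  have Hw i : exists w, P w /\ B (v i - w).
    by have [w Pw Bw] := HZ _ (Zv i); exists w.
  have [w wP] := choice Hw; exists w => [i|c Bc]; first by case: (wP i).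
  apply: iv.
  have -> : \sum_i c i *: v i = \sum_i c i *: (v i - w i) + \sum_i c i *: w i.
    by rewrite -big_split; apply: eq_bigr => i _ /=; rewrite -scalerDr subrK.
  by apply: subspaceD => //; apply: subspace_sum => // i; case: (wP i).
have [w1 P1w1 iw1] := lift_family _ _ _ _ _ Zv1 hB1 HZ1 iv1.
have [w2 P2w2 iw2] := lift_family _ _ _ _ _ Zv2 hB2 HZ2 iv2.
rewrite -!EFinD -!natrD.
pose F (i : 'I_(m2 + (m1 + k))) : E := match fintype.split i with
  | inl a => w2 a
  | inr b => match fintype.split b with inl a => w1 a | inr a => v3 a end
  end.
have F2 a : F (lshift _ a) = w2 a.
  by rewrite /F -[lshift _ _]/(unsplit (inl _)) unsplitK.
have F1 a : F (rshift _ (lshift _ a)) = w1 a.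
  rewrite /F -[rshift _ _]/(unsplit (inr _)) unsplitK.
  by rewrite -[lshift _ _]/(unsplit (inl _)) unsplitK.
have F3 a : F (rshift _ (rshift _ a)) = v3 a.
  rewrite /F -[rshift m2 _]/(unsplit (inr _)) unsplitK.
  by rewrite -[rshift _ _]/(unsplit (inr _)) unsplitK.
apply: (@dim_quotient_ge C X _ F) => [i|c].
  rewrite /F; case: (fintype.split i) => [a|b]; first exact: P2C.
  by case: (fintype.split b) => a; [exact: P1C|exact: Z3C].
rewrite !big_split_ord /=.
under eq_bigr do rewrite F2.
under [X in _ + (X + _)]eq_bigr do rewrite F1.
under [X in _ + (_ + X)]eq_bigr do rewrite F3.
set p2 := \sum_(i < m2) _; set p1 := \sum_(i < m1) _; set p3 := \sum_(i < k) _.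
move=> Xp.
have P1p1 : P1 p1 by exact: subspace_sum.
have P2p2 : P2 p2 by exact: subspace_sum.
have Z3p3 : Z3 p3 by exact: subspace_sum.
have [|B1p1 B2p2] := HX _ _ _ P1p1 P2p2 Z3p3; first by rewrite (addrC p1) -addrA.
have c1 := iw1 _ B1p1; have c2 := iw2 _ B2p2.
have p10 : p1 = 0 by rewrite /p1 big1 // => a _; rewrite c1 scale0r.
have p20 : p2 = 0 by rewrite /p2 big1 // => a _; rewrite c2 scale0r.
rewrite p10 p20 !add0r in Xp.
have c3 := iv3 _ (XB3 _ (conj Xp Z3p3)).
move=> i; rewrite -(splitK i); case: (fintype.split i) => [a|b]; first exact: c2.
by rewrite -(splitK b); case: (fintype.split b) => a; [exact: c1|exact: c3].
Qed.

End DimQuotient.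

(** * The second cohomology *)

Lemma addr_subDA (V : zmodType) (a b c : V) : b + c = a + b - (a - c).
Proof. by rewrite opprB [a + b]addrC -addrA (addrCA a) subrr addr0. Qed.

Lemma addr_sub_split (V : zmodType) (a b c e : V) :
  a - (b - c) = a - b - e + (e + c).
Proof. by rewrite opprB addrA [RHS]addrA subrK addrAC. Qed.

Lemma addr_scalerACA (K : pzRingType) (V : lmodType K) (k : K) (a b c e : V) :
  k *: (a + b) + (c + e) = k *: a + c + (k *: b + e).
Proof. by rewrite scalerDr addrACA. Qed.

Section Frolicher.
Variables (R : realType) (n : nat) (M : complex_manifold R n).
Local Notation d := (@ext_d R n M).
Implicit Types (w u v : components M) (S : nat -> nat -> bool) (r : nat).

Local Opaque ext_d del delbar cjf projf.

Definition supported S : set (components M) := [set w | is_form w /\ supp S w].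

Definition closed_supported S : set (components M) :=
  [set w | supported S w /\ d w = 0].

(** Degrees and filtration indices are integers, possibly negative, but only the values of P on
    natural bidegrees matter. *)
Lemma forms_of_bidegreeE (P : int -> int -> Prop) S :
  (forall p q : nat, P p%:Z q%:Z <-> S p q) ->
  @forms_of_bidegree R n M P = supported S.
Proof.
move=> PS; apply/seteqP; split=> w [fw wP]; split=> // i s x.
  by move=> nS; apply/eqP/negPn/negP => /wP /PS; exact/negP.
move=> wn0; apply/PS; apply/negPn/negP => /(wP i s x) w0.
by rewrite w0 eqxx in wn0.
Qed.

Lemma supported0 S : supported S 0.
Proof. by split; [exact: is_form0|exact: supp0]. Qed.

Lemma supported_lin S (k : R[i]) w1 w2 : supported S w1 -> supported S w2 ->
  supported S (k *: w1 + w2).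
Proof.
move=> [f1 s1] [f2 s2]; rewrite -(scale1r w2).
by split; [exact: is_form_lin|exact: supp_lin].
Qed.

Lemma supported_subspace S : subspace_of (supported S).
Proof. by split; [exact: supported0|move=> k x y; exact: supported_lin]. Qed.

Lemma ext_d_linl (k : R[i]) w1 w2 : is_form w1 -> is_form w2 ->
  d (k *: w1 + w2) = k *: d w1 + d w2.
Proof.
by move=> f1 f2; rewrite -[in LHS](scale1r w2) ext_d_lin // scale1r.
Qed.

Lemma closed_subspace S : subspace_of (closed_supported S).
Proof.
split=> [|k x y [Sx dx] [Sy dy]].
  by split; [exact: supported0|exact: ext_d0].
split; first exact: supported_lin.
by rewrite (ext_d_linl k Sx.1 Sy.1) dx dy scaler0 addr0.
Qed.

Lemma exact_subspace S : subspace_of (d @` supported S).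
Proof.
split=> [|k _ _ [x Sx <-] [y Sy <-]].
  by exists 0; [exact: supported0|exact: ext_d0].
exists (k *: x + y); first exact: supported_lin.
exact: (ext_d_linl k Sx.1 Sy.1).
Qed.

(** * The term of bidegree (0,2) on page r *)

Definition frolicher_Z02 r : set (components M) :=
  [set w | supported (fun p q => p + q == 2)%N w /\
           supported (fun p q => (p + q == 3) && (r <= p))%N (d w)].

Definition frolicher_B02 r : set (components M) :=
  [set w | exists u v, [/\ supported (fun p q => (p + q == 2) && (1 <= p))%N u,
     supported (fun p q => (p + q == 3) && (r <= p))%N (d u),
     supported (fun p q => p + q == 1)%N v & w = u + d v]].

Lemma frolicher_Z02E r : @frolicher_Z R n M r%:Z 0 2 = frolicher_Z02 r.
Proof.
rewrite /frolicher_Z /hodge_filtration.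
rewrite (forms_of_bidegreeE (S := fun p q => p + q == 2)%N);
  last by move=> p q; split; lia.
rewrite (forms_of_bidegreeE (S := fun p q => (p + q == 3) && (r <= p))%N) //.
by move=> p q; split; lia.
Qed.

Lemma supported_d S S' w :
  (forall p q, (((0 < p)%N && S p.-1 q) || ((0 < q)%N && S p q.-1)) -> S' p q) ->
  supported S w -> supported S' (d w).
Proof.
move=> SS' [fw sw]; split; first exact: is_form_d.
by apply: supp_sub (supp_d sw) => p q; exact: SS'.
Qed.

(** For v the conditions are v in F^{1-r} Omega^1 and d v in F^0 Omega^2. Once r >= 1 both hold for
    every 1-form, bidegrees being nonnegative. *)
Lemma frolicher_B02E r : (1 <= r)%N -> @frolicher_B R n M r%:Z 0 2 = frolicher_B02 r.
Proof.
move=> r1; rewrite /frolicher_B /frolicher_Z /hodge_filtration.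
rewrite (forms_of_bidegreeE (S := fun p q => (p + q == 2) && (1 <= p))%N);
  last by move=> p q; split; lia.
rewrite (forms_of_bidegreeE (S := fun p q => (p + q == 3) && (r <= p))%N);
  last by move=> p q; split; lia.
rewrite (forms_of_bidegreeE (S := fun p q => p + q == 1)%N);
  last by move=> p q; split; lia.
rewrite (forms_of_bidegreeE (S := fun p q => p + q == 2)%N);
  last by move=> p q; split; lia.
apply/seteqP; split=> [_ [u [Su Sdu] [v [Sv _] <-]]|w [u [v [Su Sdu Sv ->]]]].
  by exists u, v.
exists u; first by split.
exists v; last by [].
by split; [exact: Sv|apply: supported_d Sv => p q; lia].
Qed.

Lemma frolicher_Z02_subspace r : subspace_of (frolicher_Z02 r).
Proof.
split=> [|k x y [Sx dx] [Sy dy]].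
  by split; rewrite ?ext_d0; exact: supported0.
split; first exact: supported_lin.
by rewrite (ext_d_linl k Sx.1 Sy.1); exact: supported_lin.
Qed.

Lemma frolicher_B02_subspace r : subspace_of (frolicher_B02 r).
Proof.
split=> [|k _ _ [u [v [Su du Sv ->]]] [u' [v' [Su' du' Sv' ->]]]].
  exists 0, 0; rewrite ext_d0 addr0.
  by split; [exact: supported0|exact: supported0|exact: supported0|].
exists (k *: u + u'), (k *: v + v'); split.
- exact: supported_lin.
- by rewrite (ext_d_linl k Su.1 Su'.1); exact: supported_lin.
- exact: supported_lin.
- by rewrite (ext_d_linl k Sv.1 Sv'.1); exact: addr_scalerACA.
Qed.

Lemma cjf_preimage_subspace (T : set (components M)) :
  subspace_of T -> subspace_of ((@cjf R n M) @^-1` T).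
Proof.
move=> hT; split=> [|k x y Tx Ty]; rewrite /preimage /=.
  by rewrite cjf0; exact: hT.1.
by rewrite cjfD cjfZ; exact: hT.2.
Qed.

Lemma supported_cjf S S' w : (forall p q, S q p = S' p q) ->
  supported S w -> supported S' (cjf w).
Proof.
move=> SS' [fw sw]; split; first exact: is_form_cjf.
by apply: supp_sub (supp_cjf sw) => p q; rewrite SS'.
Qed.

Lemma supported_sub S S' w : (forall p q, S p q -> S' p q) ->
  supported S w -> supported S' w.
Proof. by move=> SS' [fw sw]; split=> //; exact: supp_sub sw. Qed.

Lemma supported_projf S p q w : supported S w ->
  supported (fun p' q' => (p' == p) && (q' == q)) (projf p q w).
Proof.
move=> [fw sw]; split; first exact: is_form_projf.
have sp := @supp_projf _ _ _ S p q w sw.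
by apply: supp_sub sp => p' q' /andP[].
Qed.

Lemma supported1_split w : supported (fun p q => p + q == 1)%N w ->
  w = projf 1 0 w + projf 0 1 w.
Proof.
move=> [fw sw]; apply/funext => i; apply/funext => s; apply/funext => x.
rewrite -[RHS]/(projf 1 0 w i s x + projf 0 1 w i s x) !projfE.
case: ifP => [/andP[/eqP-> _]|E1]; first by rewrite addr0.
case: ifP => [_|E2]; first by rewrite add0r.
rewrite addr0; apply: sw; move: E1 E2; lia.
Qed.

Lemma closed_in_both_filtrations r w :
  closed_supported (fun p q => p + q == 2)%N w ->
  frolicher_B02 r w -> frolicher_B02 r (cjf w) ->
  exists2 z, closed_supported (fun p q => (p == 1) && (q == 1))%N z &
    (d @` supported (fun p q => p + q == 1)%N) (w - z).
Proof.
move=> [Sw dw] [u [v [Su _ Sv wE]]] [u' [v' [Su' _ Sv' cwE]]].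
have Scv' : supported (fun p q => p + q == 1)%N (cjf v').
  by apply: supported_cjf Sv' => p q; rewrite addnC.
pose eta := cjf v' - v.
have Seta : supported (fun p q => p + q == 1)%N eta.
  by apply: subspaceB; [exact: supported_subspace|exact: Scv'|exact: Sv].
have deta : d eta = u - cjf u'.
  rewrite [LHS](ext_dB Scv'.1 Sv.1) ext_d_cjf; last exact: Sv'.1.
  have : w = cjf u' + cjf (d v') by rewrite -cjfD -cwE cjfK.
  move=> E; apply/eqP; rewrite subr_eq addrAC eq_sym subr_eq -wE addrC.
  by rewrite E.
have S10 := supported_projf 1 0 Seta; have S01 := supported_projf 0 1 Seta.
pose z := u - d (projf 1 0 eta).
have zE : z = cjf u' + d (projf 0 1 eta).
  rewrite /z; apply/eqP; rewrite subr_eq -addrA [d _ + d _]addrC.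
  rewrite -(ext_dD S10.1 S01.1) -(supported1_split Seta).
  by rewrite deta addrC subrK.
exists z; last first.
  exists (v + projf 1 0 eta).
    apply: (subspaceD (supported_subspace _)) => //.
    by apply: supported_sub S10 => p q; lia.
  rewrite (ext_dD Sv.1 S10.1) /z wE.
  exact: addr_subDA.
(* d eta^{1,0} has types (2,0) and (1,1), so z stays in F^1; its other expression shows in the same
   way that only types with q >= 1 occur. *)
have Sz : supported (fun p q => (p + q == 2) && (1 <= p))%N z.
  apply: subspaceB; [exact: supported_subspace|exact: Su|].
  by apply: supported_d S10 => p q; lia.
split.
  split; first exact: Sz.1.
  have sz' : supp (fun p q => (p + q == 2) && (1 <= q))%N z.
    rewrite zE; apply: suppD.
      have [] : supported (fun p q => (p + q == 2) && (1 <= q))%N (cjf u') => //.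
      by apply: supported_cjf Su' => p q; rewrite addnC.
    have [] : supported (fun p q => (p + q == 2) && (1 <= q))%N
        (d (projf 0 1 eta)) => //.
      by apply: supported_d S01 => p q; lia.
  by apply: supp_sub (supp_and Sz.2 sz') => p q; lia.
(* Here d z = d u = d w = 0. *)
rewrite (ext_dB Su.1 (is_form_d S10.1)).
rewrite (ext_d_ext_d S10.1) subr0.
have := dw; rewrite wE (ext_dD Su.1 (is_form_d Sv.1)).
by rewrite (ext_d_ext_d Sv.1) addr0.
Qed.

Lemma cjfB w1 w2 : cjf (w1 - w2) = cjf w1 - cjf w2.
Proof. by rewrite cjfD -scaleN1r cjfZ rmorphN rmorph1 scaleN1r. Qed.

(** Since delbar squares to 0, del delbar xi = d (delbar xi): Bott-Chern relations are de Rham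
    relations. *)
Lemma ddbar_exact :
  (fun w => del (delbar w)) @` supported (fun p q => (p == 0) && (q == 0))%N
  `<=` d @` supported (fun p q => p + q == 1)%N.
Proof.
move=> _ [xi [fxi sxi] <-]; exists (delbar xi).
  split; first exact: is_form_delbar sxi.
  by apply: supp_sub (supp_delbar sxi) => p q; lia.
by rewrite ext_d_del_delbar (delbar_delbar fxi) addr0.
Qed.

(** Injectivity of H_BC^{1,1} -> H^2. A closed form of pure type is closed under del and delbar, as
    these are components of its differential. *)
Lemma ddbar_exactness : ddbar_lemma M ->
  d @` supported (fun p q => p + q == 1)%N `&`
    closed_supported (fun p q => (p == 1) && (q == 1))%N
  `<=` (fun w => del (delbar w)) @` supported (fun p q => (p == 0) && (q == 0))%N.
Proof.
move=> H w [[eta [feta _] etaw] [[fw sw] dw]].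
have pr0 p q : projf p q 0 = 0 :> components M.
  by apply: (@projf0 _ _ _ (fun _ _ => false)).
have : ((fun w => del (delbar w)) @` [set w | is_form w]) w.
  rewrite -H; split; last by exists eta.
  by split; split=> //; rewrite ?(del_pure sw) ?(delbar_pure sw) dw pr0.
(* The form xi may have mixed type; its (0,0) part alone accounts for the (1,1) form w. *)
move=> [xi fxi xiw]; exists (projf 0 0 xi).
  by apply: (@supported_projf (fun _ _ => true)); split.
by rewrite delbar_projf del_projf xiw projf_id.
Qed.

Lemma ddbar_degeneration r w : ddbar_lemma M -> (1 <= r)%N -> frolicher_Z02 r w ->
  exists2 w', closed_supported (fun p q => (p == 0) && (q == 2))%N w' &
    frolicher_B02 r (w - w').
Proof.
move=> H r1 [Sw Sdw].
have [fw sw] := Sw; have [fdw sdw] := Sdw.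
pose w02 := projf 0 2 w.
have [f02 s02] : supported (fun p q => (p == 0) && (q == 2))%N w02.
  exact: supported_projf Sw.
have dbar0 : delbar w02 = 0.
  rewrite /w02 delbar_projf.
  (* The (0,3) component of d w is delbar w^{0,2}; it vanishes because d w lies in F^r with r >=
     1. *)
  have : projf 0 3 (d w) = 0 by apply: projf0 sdw _; rewrite negb_and -ltnNge r1.
  rewrite ext_d_del_delbar projfD (projf0 (supp_del sw)) ?add0r //.
have fk : is_form (del w02) by exact: is_form_del s02.
have dk : d w02 = del w02 by rewrite ext_d_del_delbar dbar0 addr0.
(* [del w02] equals [d w02], so it is d-exact, and it is closed under both operators. *)
have : ((fun w => del (delbar w)) @` [set w | is_form w]) (del w02).
  rewrite -H; split; last by exists w02.
  split; (split; [exact: fk|]); first exact: del_del.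
  apply/eqP; rewrite -oppr_eq0 -(del_delbar f02) dbar0; apply/eqP.
  exact: partial_d0.
(* Only the (0,1) part of xi contributes to type (1,2). *)
move=> [xi fxi xiE]; pose xi1 := projf 0 1 xi.
have [fx1 sx1] : supported (fun p q => (p == 0) && (q == 1))%N xi1.
  by apply: (@supported_projf (fun _ _ => true)); split.
have xi1E : del (delbar xi1) = del w02.
  rewrite /xi1 delbar_projf del_projf xiE; apply: projf_id.
  by apply: supp_sub (supp_del s02) => p q; lia.
have fb : is_form (delbar xi1) by exact: is_form_delbar sx1.
have sb : supp (fun p q => (p == 0) && (q == 2))%N (delbar xi1).
  by apply: supp_sub (supp_delbar sx1) => p q; lia.
have dw' : d (w02 - delbar xi1) = 0.
  rewrite (ext_dB f02 fb) dk [d (delbar _)]ext_d_del_delbar.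
  by rewrite (delbar_delbar fx1) addr0 xi1E; exact: subrr.
have S' : supported (fun p q => (p == 0) && (q == 2))%N (w02 - delbar xi1).
  by apply: subspaceB; [exact: supported_subspace|split|split].
exists (w02 - delbar xi1); first by split.
have E : w - (w02 - delbar xi1) = (w - w02 - del xi1) + d xi1.
  by rewrite ext_d_del_delbar; exact: addr_sub_split.
(* The F^1 part has lost its (0,2) component, and its differential is that of w, since w' and d xi1
   are closed. *)
exists (w - w02 - del xi1), xi1; split; last exact: E; last first.
- by split; [exact: fx1|apply: supp_sub sx1 => p q; lia].
- have -> : d (w - w02 - del xi1) = d w; last exact: Sdw.
  have -> : w - w02 - del xi1 = w - (w02 - delbar xi1) - d xi1.
    by rewrite E addrK.
  rewrite (ext_dB (is_formB fw S'.1) (is_form_d fx1)) (ext_d_ext_d fx1) subr0.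
  by rewrite (ext_dB fw S'.1) dw'; exact: subr0.
split; first by apply: is_formB; [exact: is_formB|exact: is_form_del sx1].
move=> i s x nS; rewrite -[LHS]/(w i s x - w02 i s x - del xi1 i s x).
rewrite (supp_del sx1); last by move: nS; lia.
rewrite subr0 /w02 projfE; case: ifP => [_|E2]; first by rewrite subrr.
by rewrite sw; [exact: subrr|move: nS E2; lia].
Qed.

(** From w1 = - w2 + d eta: the form - w2 is closed and in F^1, which makes w1 zero on every
    page. *)
Lemma exact_sum_in_B02 r (w1 w2 : components M) :
  closed_supported (fun p q => (p == 0) && (q == 2))%N w1 ->
  closed_supported (fun p q => (p + q == 2) && (1 <= p))%N w2 ->
  (d @` supported (fun p q => p + q == 1)%N) (w1 + w2) -> frolicher_B02 r w1.
Proof.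
move=> [S1 d1] [S2 d2] [eta Seta etaE].
exists (- w2), eta.
have dN : d (- w2) = 0.
  by have := ext_dB (@is_form0 _ _ M) S2.1; rewrite !sub0r ext_d0 d2 subr0.
split=> //.
- rewrite -sub0r; apply: subspaceB => //; first exact: supported_subspace.
  exact: supported0.
- by rewrite dN; exact: supported0.
- by rewrite etaE addrC addrK.
Qed.

End Frolicher.

Theorem proposition4p6 (R : realType) (n : nat) (M : complex_manifold R n)
    (M_compact : compact [set: M]) :
  (forall r : nat, (1 <= r)%N ->
     (betti M 2 <= dim_bott_chern M 1 1 + 2%:R%:E * dim_frolicher M r 0 2)%E)
  /\
  (ddbar_lemma M -> forall r : nat, (1 <= r)%N ->
     (dim_bott_chern M 1 1 + 2%:R%:E * dim_frolicher M r 0 2)%E = betti M 2).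
Proof.
pose C := closed_supported (M := M) (fun p q => p + q == 2)%N.
pose X := @ext_d R n M @` supported (M := M) (fun p q => p + q == 1)%N.
pose Z3 := closed_supported (M := M) (fun p q => (p == 1) && (q == 1))%N.
pose B3 := (fun w => del (delbar w)) @`
  supported (M := M) (fun p q => (p == 0) && (q == 0))%N.
have bettiE : betti M 2 = dim_quotient C X.
  have E2 : Omega_deg M 2 = supported (M := M) (fun p q => p + q == 2)%N.
    by apply: forms_of_bidegreeE => p q; split; lia.
  have E1 : Omega_deg M (2 - 1) = supported (M := M) (fun p q => p + q == 1)%N.
    by apply: forms_of_bidegreeE => p q; split; lia.
  by rewrite /betti E2 E1.
have bcE : dim_bott_chern M 1 1 = dim_quotient Z3 B3.
  have E1 : Omega_pq M 1 1 = supported (M := M) (fun p q => (p == 1) && (q == 1))%N.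
    by apply: forms_of_bidegreeE => p q; split; lia.
  have E0 : Omega_pq M (1 - 1) (1 - 1) =
      supported (M := M) (fun p q => (p == 0) && (q == 0))%N.
    by apply: forms_of_bidegreeE => p q; split; lia.
  rewrite /dim_bott_chern E1 E0; reflexivity.
have froE r : (1 <= r)%N -> dim_frolicher M r 0 2 =
    dim_quotient (@frolicher_Z02 R n M r) (@frolicher_B02 R n M r).
  by move=> r1; rewrite /dim_frolicher frolicher_Z02E frolicher_B02E.
have cjf_linear (k l : R[i]) (x y : components M) :
  cjf (k *: x + l *: y) = (k^*)%C *: cjf x + (l^*)%C *: cjf y.
  by rewrite cjfD !cjfZ.
have le r : (1 <= r)%N ->
    (betti M 2 <= dim_bott_chern M 1 1 + 2%:R%:E * dim_frolicher M r 0 2)%E.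
  move=> r1; rewrite bettiE bcE froE // mule_natl mule2n.
  have := dim_quotient_conj (@frolicher_Z02 R n M r) (@frolicher_B02 R n M r)
    cjf_linear.
  (* One of the two copies of the dimension is replaced by that of the conjugate page. *)
  move=> cj; apply: le_trans (leeD2l _ (leeD2l _ cj)).
  have Z02 w : C w -> @frolicher_Z02 R n M r w.
    by move=> [Sw dw]; split=> //; rewrite dw; exact: supported0.
  apply: dim_quotient_le_sum.
  - exact: closed_subspace.
  - exact: exact_subspace.
  - exact: frolicher_B02_subspace.
  - by apply: cjf_preimage_subspace; exact: frolicher_B02_subspace.
  - exact: frolicher_Z02_subspace.
  - by apply: cjf_preimage_subspace; exact: frolicher_Z02_subspace.
  - exact: Z02.
  - move=> w [Sw dw]; apply: Z02; split.
      by apply: supported_cjf Sw => p q; rewrite addnC.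
    by rewrite (ext_d_cjf Sw.1) dw cjf0.
  - exact: ddbar_exact.
  - by move=> w Cw B1w B2w; exact: closed_in_both_filtrations Cw B1w B2w.
split; [exact: le|move=> ddbar r r1]; apply/eqP; rewrite eq_le le // andbT.
rewrite bettiE bcE froE // mule_natl mule2n.
pose Z02 := @frolicher_Z02 R n M r; pose B02 := @frolicher_B02 R n M r.
have pK (T : set (components M)) : @cjf R n M @^-1` (@cjf R n M @^-1` T) = T.
  by apply/funext => w; rewrite /preimage /= cjfK.
(* The reverse comparison with the conjugate page, available because conjugation is an
   involution. *)
have cj : (dim_quotient Z02 B02 <=
    dim_quotient (@cjf R n M @^-1` Z02) (@cjf R n M @^-1` B02))%E.
  by rewrite -{1}(pK Z02) -{1}(pK B02); exact: dim_quotient_conj.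
apply: (le_trans (leeD2l _ (leeD2l _ cj))).
pose P1 := closed_supported (M := M) (fun p q => (p == 0) && (q == 2))%N.
have P1C w : P1 w -> C w.
  by move=> [Sw dw]; split=> //; apply: supported_sub Sw => p q; lia.
have cjfC w : C (cjf w) -> C w.
  move=> [Sw dw]; rewrite -(cjfK w); split.
    by apply: supported_cjf Sw => p q; rewrite addnC.
  by rewrite (ext_d_cjf Sw.1) dw cjf0.
(* The representatives are the closed forms of type (0,2) and, as the conjugate of [P1], those of
   type (2,0). *)
apply: (@dim_quotient_sum_le _ _ _ _ _ _ _ _ _ _ P1 (@cjf R n M @^-1` P1)).
- exact: frolicher_B02_subspace.
- by apply: cjf_preimage_subspace; exact: frolicher_B02_subspace.
- exact: closed_subspace.
- by apply: cjf_preimage_subspace; exact: closed_subspace.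
- exact: closed_subspace.
- exact: P1C.
- by move=> w P1w; apply: cjfC; exact: P1C.
- by move=> w [Sw dw]; split=> //; apply: supported_sub Sw => p q; lia.
- by move=> w Zw; exact: ddbar_degeneration.
- move=> w Zw; have [w' P1w' Bw] := ddbar_degeneration ddbar r1 Zw.
  exists (cjf w'); rewrite /preimage /= ?cjfK //.
  by rewrite cjfB cjfK.
- move=> p1 p2 p3 P1p1 P1p2 Z3p3 Xp.
  pose C1 := closed_supported (M := M) (fun p q => (p + q == 2) && (1 <= p))%N.
  have C1Z3 w : Z3 w -> C1 w.
    by move=> [Sw dw]; split=> //; apply: supported_sub Sw => p q; lia.
  have C1P1 w : P1 w -> C1 (cjf w).
    move=> [Sw dw]; split; last by rewrite (ext_d_cjf Sw.1) dw cjf0.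
    apply: (@supported_cjf _ _ _ (fun p q => (p + q == 2) && (1 <= q))%N).
      by move=> p q; rewrite addnC.
    by apply: supported_sub Sw => p q; lia.
  have hC1 : subspace_of C1 by exact: closed_subspace.
  have Z3cj w : Z3 w -> Z3 (cjf w).
    move=> [Sw dw]; split; last by rewrite (ext_d_cjf Sw.1) dw cjf0.
    by apply: supported_cjf Sw => p q; rewrite andbC.
  (* p2 + p3 has types (2,0) and (1,1) and so lies in F^1, which sends p1 to zero in the page. *)
  split.
    have C1p2 : C1 p2 by rewrite -(cjfK p2); exact: C1P1 P1p2.
    rewrite -addrA in Xp.
    exact: (exact_sum_in_B02 r P1p1 (subspaceD hC1 C1p2 (C1Z3 _ Z3p3)) Xp).
  (* The conjugate relation exchanges the roles of p1 and p2. *)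
  have C1p13 := subspaceD hC1 (C1P1 _ P1p1) (C1Z3 _ (Z3cj _ Z3p3)).
  have X2 : X (cjf p2 + (cjf p1 + cjf p3)).
    rewrite addrA (addrC (cjf p2)) -!cjfD.
    case: Xp => eta Seta <-; exists (cjf eta); last by rewrite (ext_d_cjf Seta.1).
    by apply: supported_cjf Seta => p q; rewrite addnC.
  exact: (exact_sum_in_B02 r (P1p2 : P1 (cjf p2)) C1p13 X2).
- exact: ddbar_exactness.
Qed.
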